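(* Fix a constant $\delta\in(0,1/2)$, and let $k=n^\delta$ (rounded to an integer) and let $d=d(n)$ be an integer with $d\ge\log_2 n$ and $d=O(\log n)$. Let $V_{\mathrm{bin}}$ be the $n2^d\times kd$ binary Vandermonde matrix over $\mathbb{F}_2$ (defined in the context). For $x\in\{0,1\}^{n2^d}$, regarded as a column vector over $\mathbb{F}_2$, let $f(x)=1$ if $V_{\mathrm{bin}}^{T}x=0$ and $f(x)=0$ otherwise. Then $\mathrm{MFS}(f)=n^{\Omega(\log n)}$, i.e. there is a constant $c>0$ with $\mathrm{MFS}(f)\ge n^{c\log n}$ for all sufficiently large $n$.
   Context: Binary Vandermonde matrix. Interpret $\mathbb{F}_{2^d}$ as the field of polynomials over $\mathbb{F}_2$ modulo some irreducible polynomial of degree $d$, and encode each element by its $d\times1$ vector of coefficients. For $a\in\mathbb{F}_{2^d}$ let $m(a)$ be the $d\times d$ matrix over $\mathbb{F}_2$ that maps (the encoding of) $q\in\mathbb{F}_{2^d}$ to (the encoding of) $aq$. Let $H$ be the $2^d\times d$ matrix over $\mathbb{F}_2$ mapping a vector $u\in\mathbb{F}_2^d$ to its length-$2^d$ Hadamard encoding $(w^{T}u)_{w\in\mathbb{F}_2^d}$. Let $1,\dots,n$ denote labels of $n$ distinct elements of $\mathbb{F}_{2^d}$. Then $V_{\mathrm{bin}}$ is the block matrix whose $(i,j)$ block, for $i\in\{1,\dots,n\}$ and $j\in\{0,\dots,k-1\}$, is the $2^d\times d$ matrix $H\,m(i^{j})$ (powers taken in $\mathbb{F}_{2^d}$).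 Multilinear formulas. An arithmetic formula over $\mathbb{C}$ in variables $x_1,\dots,x_N$ is a rooted binary tree whose leaves are labeled with complex numbers or variables and whose non-leaf vertices are labeled $+$ or $\times$; it computes a polynomial in the obvious way. A polynomial is multilinear if no variable appears raised to a power higher than $1$; a formula is multilinear if the polynomial computed by each of its subtrees is multilinear. The size of a formula is its number of leaves. For $f:\{0,1\}^N\to\mathbb{C}$, $\mathrm{MFS}(f)$ is the minimum size of a multilinear formula computing a multilinear polynomial $p$ with $p(x)=f(x)$ for all $x\in\{0,1\}^N$. *)

(* Defs.v *)
From HB Require Import structures.
From mathcomp Require Import all_boot all_order all_algebra all_field.
From mathcomp Require Import boolp.
From mathcomp.multinomials Require Import mpoly.

Set Implicit Arguments.
Unset Strict Implicit.
Unset Printing Implicit Defensive.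

Import GRing.Theory.
Local Open Scope ring_scope.

(** * Multilinear formulas *)

Section Formulas.
Variables (K : comNzRingType) (N : nat).

Inductive formula : Type :=
| Const of K
| Var of 'I_N
| Add of formula & formula
| Mul of formula & formula.

Fixpoint formula_size (F : formula) : nat :=
  match F with
  | Const _ | Var _ => 1
  | Add A B | Mul A B => formula_size A + formula_size B
  end.

Fixpoint formula_poly (F : formula) : {mpoly K[N]} :=
  match F with
  | Const c => c%:MP
  | Var i => 'X_i
  | Add A B => formula_poly A + formula_poly B
  | Mul A B => formula_poly A * formula_poly B
  end.

Definition multilinear_poly (p : {mpoly K[N]}) : bool :=
  all (fun m : 'X_{1..N} => [forall i, (m i <= 1)%N]) (msupp p).

Fixpoint multilinear_formula (F : formula) : bool :=
  multilinear_poly (formula_poly F) &&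
  match F with
  | Const _ | Var _ => true
  | Add A B | Mul A B => multilinear_formula A && multilinear_formula B
  end.

Definition cube : Type := {ffun 'I_N -> bool}.

Definition represents (F : formula) (f : cube -> K) : Prop :=
  forall x : cube, (formula_poly F).@[fun i => (x i)%:R] = f x.

Definition has_formula_of_size (f : cube -> K) (s : nat) : Prop :=
  exists F : formula,
    [/\ multilinear_formula F, represents F f & formula_size F = s].

(* The minimum in the definition of MFS is over a nonempty set: the formula
   below interpolates f one variable at a time. *)
Definition cube_set (x : cube) (j : 'I_N) (b : bool) : cube :=
  [ffun l => if l == j then b else x l].

Fixpoint interp (f : cube -> K) (i : nat) (x : cube) : formula :=
  match i with
  | 0 => Const (f x)
  | i'.+1 =>
    match insub i' : option 'I_N with
    | None => Const 0
    | Some j =>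
      Add (Mul (Add (Const 1) (Mul (Const (-1)) (Var j)))
               (interp f i' (cube_set x j false)))
          (Mul (Var j) (interp f i' (cube_set x j true)))
    end
  end.

Let low (i : nat) (p : {mpoly K[N]}) : Prop :=
  forall m : 'X_{1..N}, m \in msupp p -> forall l : 'I_N, (m l <= (l < i))%N.

Let low_multilinear i p : low i p -> multilinear_poly p.
Proof.
move=> lp; apply/allP=> m /lp ml; apply/forallP=> l.
by apply: leq_trans (ml l) _; case: (_ < _)%N.
Qed.

Let lowC i c : low i c%:MP.
Proof.
move=> m; rewrite msuppC; case: eqP => // _; rewrite inE => /eqP-> l.
by rewrite mnm0E.
Qed.

Let lowD i p q : low i p -> low i q -> low i (p + q).
Proof.
move=> lp lq m /msuppD_le; rewrite mem_cat => /orP[]; [exact: lp|exact: lq].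
Qed.

Let lowS i p : low i p -> low i.+1 p.
Proof.
move=> lp m /lp ml l; apply: leq_trans (ml l) _.
by rewrite ltnS; case: ltngtP.
Qed.

Let lowX (j : 'I_N) : low j.+1 'X_j.
Proof.
move=> m; rewrite msuppX inE => /eqP-> l; rewrite mnm1E.
by case: eqP => // <-; rewrite ltnSn.
Qed.

Let lowCM i c p : low i p -> low i (c%:MP * p).
Proof. by move=> lp m; rewrite mul_mpolyC => /msuppZ_le /lp. Qed.

Let lowXM (j : 'I_N) p : low j p -> low j.+1 ('X_j * p).
Proof.
move=> lp m /msuppM_le /allpairsP[[m1 m2] /= [+ + ->]].
rewrite msuppX inE => /eqP-> /lp m2l l; rewrite mnmDE mnm1E.
have := m2l l; case: (eqVneq j l) => [<-|ne].
  by rewrite ltnn leqn0 => /eqP->; rewrite ltnSn.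
by rewrite add0n => /leq_trans-> //; rewrite ltnS; case: ltngtP.
Qed.

Lemma interp_multilinear (f : cube -> K) i x :
  (i <= N)%N -> multilinear_formula (interp f i x).
Proof.
move=> leiN; suff [] : multilinear_formula (interp f i x) /\
  low i (formula_poly (interp f i x)) by [].
elim: i x leiN => [|i IH] x leiN /=.
  by rewrite (low_multilinear (@lowC 0 _)); split=> //; exact: lowC.
case: insubP => [j _ ji|]; last by rewrite leiN.
have {IH} [[M0 L0] [M1 L1]] :=
  (IH (cube_set x j false) (ltnW leiN), IH (cube_set x j true) (ltnW leiN)).
rewrite -{}ji in M0 L0 M1 L1 *.
have lX := @lowX j.
have lNX : low j.+1 ((-1)%:MP * 'X_j) by exact: lowCM.
have l1X : low j.+1 (1%:MP + (-1)%:MP * 'X_j) by apply: lowD => //; exact: lowC.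
have lA : low j.+1 ((1%:MP + (-1)%:MP * 'X_j) *
                    formula_poly (interp f j (cube_set x j false))).
  rewrite mulrDl -mulrA; apply: lowD; first by apply: lowCM; exact: lowS.
  by apply: lowCM; exact: lowXM.
have lB := lowXM L1.
have lAB := lowD lA lB.
split=> //=.
rewrite M0 M1 (low_multilinear lAB) (low_multilinear lA) (low_multilinear lB).
rewrite (low_multilinear lX) (low_multilinear lNX) (low_multilinear l1X).
by rewrite !(low_multilinear (@lowC 0 _)).
Qed.

Lemma interp_eval (f : cube -> K) i (x y : cube) :
    (i <= N)%N -> (forall l : 'I_N, (i <= l)%N -> y l = x l) ->
  (formula_poly (interp f i x)).@[fun l => (y l)%:R] = f y.
Proof.
elim: i x => [|i IH] x leiN yx /=.
  by rewrite mevalC; congr f; apply/ffunP=> l; rewrite yx.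
case: insubP => [j _ ji|]; last by rewrite leiN.
have agree b : y j = b -> forall l : 'I_N, (i <= l)%N -> y l = cube_set x j b l.
  move=> yj l leil; rewrite ffunE; case: eqVneq => [->//|ne].
  by apply: yx; rewrite ltn_neqAle leil -ji eq_sym (inj_eq val_inj) ne.
rewrite /= !(mevalD, mevalM, mevalC, mevalXU).
case yj: (y j).
  rewrite (IH (cube_set x j true)) ?(ltnW leiN) //; last exact: agree.
  by rewrite mulr1 subrr mul0r add0r mul1r.
rewrite (IH (cube_set x j false)) ?(ltnW leiN) //; last exact: agree.
by rewrite mulr0 addr0 mul1r mul0r addr0.
Qed.

Lemma has_formula (f : cube -> K) : exists s, `[< has_formula_of_size f s >].
Proof.
exists (formula_size (interp f N [ffun=> false])); apply/asboolP.
exists (interp f N [ffun=> false]); split=> //.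
  exact: interp_multilinear.
by move=> x; apply: interp_eval => // l; rewrite leqNgt ltn_ord.
Qed.

Definition MFS (f : cube -> K) : nat := ex_minn (has_formula f).

End Formulas.

(** * The binary Vandermonde matrix *)

Section Hadamard.
Variable d : nat.

Lemma card_F2_vectors : #|{: 'rV['F_2]_d}| = (2 ^ d)%N.
Proof. by rewrite card_mx mul1n card_Fp. Qed.

(* Rows are indexed by F_2^d, listed in its standard enumeration; the row of
   index w is w^T. *)
Definition hadamard_mx : 'M['F_2]_(2 ^ d, d) :=
  \matrix_(r < 2 ^ d) enum_val (cast_ord (esym card_F2_vectors) r).

End Hadamard.

(* {poly %/ h with hI} is the field F_2[X]/(h); its elements coerce to their
   representative polynomials of degree less than that of h. The dimension d is
   meant to be the degree of h, i.e. size h = d.+1. *)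
Section Multiplication.
Variables (h : {poly 'F_2}) (hI : monic_irreducible_poly h) (d : nat).
Local Notation L := {poly %/ h with hI}.

Definition encode (q : L) : 'cV['F_2]_d :=
  \col_(i < d) (q : {poly 'F_2})`_i.

(* Column c is the encoding of a * X^c. *)
Definition mulq_mx (a : L) : 'M['F_2]_d :=
  \matrix_(r < d, c < d) encode (a * (in_qpoly h 'X^c : L)) r 0.

Lemma mulq_mxE (a q : L) :
  size h = d.+1 -> mulq_mx a *m encode q = encode (a * q).
Proof.
move=> sh.
have hE : mk_monic h = h by exact: mk_monicE.
have sq : (size (q : {poly 'F_2}) <= d)%N.
  by apply: leq_trans (size_npoly q) _; rewrite hE sh.
have qp : (q : {poly 'F_2}) = \sum_(c < d) (q : {poly 'F_2})`_c *: 'X^c.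
  by rewrite -poly_def -[LHS](take_poly_id sq).
have qE : q = \sum_(c < d) (q : {poly 'F_2})`_c *: (in_qpoly h 'X^c : L).
  rewrite -[LHS](_ : in_qpoly h (q : {poly 'F_2}) = q); last first.
    apply/val_inj/in_qpoly_small.
    by rewrite (leq_ltn_trans sq) // hE sh.
  rewrite {1}qp raddf_sum; apply: eq_bigr => c _.
  exact: in_qpolyZ.
apply/colP=> r; rewrite !mxE {2}qE mulr_sumr poly_of_qpoly_sum coef_sum.
apply: eq_bigr => c _; rewrite !mxE mulrC -scalerAr.
by rewrite poly_of_qpolyZ coefZ.
Qed.

End Multiplication.

Lemma sum_nat_const_ord a b : (\sum_(i < a) b = a * b)%N.
Proof. by rewrite sum_nat_const card_ord. Qed.

Section BinaryVandermonde.
Variables (h : {poly 'F_2}) (hI : monic_irreducible_poly h) (d n k : nat).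
Variable label : 'I_n -> {poly %/ h with hI}.

(* \mxblock has dimensions \sum_(i < n) 2 ^ d and \sum_(j < k) d; the cast only
   rewrites these as products. *)
Definition Vbin : 'M['F_2]_(n * 2 ^ d, k * d) :=
  castmx (sum_nat_const_ord n (2 ^ d), sum_nat_const_ord k d)
    (\mxblock_(i < n, j < k) (hadamard_mx d *m mulq_mx d (label i ^+ j))).

End BinaryVandermonde.

Definition cube_col N (x : cube N) : 'cV['F_2]_N := \col_i (x i)%:R.

Definition kernel_indicator (K : comNzRingType) N s (V : 'M['F_2]_(N, s))
    (x : cube N) : K :=
  (V^T *m cube_col x == 0)%:R.

(* Main.v *)
(** Raz's rank argument. A multilinear formula of size s is a sum of s products of
    t + 1 functions of disjoint sets of variables, each set holding a fraction at
    least 3^-t of all variables. Choose D = kd variables y and D variables z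
    independently and uniformly, set all others to 0, and view the function as a
    matrix indexed by the values of y and of z. A factor that sees p of the y's and
    q of the z's has rank at most 2^(min(p, q)), so a product loses a factor
    2^(sum |p - q| / 2) from full rank 2^D. Pair up the variable sets: exchanging y
    and z at the positions whose two variables fall in opposite sets of a pair gives
    independent fair random walks, so every pair of sets contributes a factor
    n^(-Omega(1)) to the mean loss, for a total of n^(-Omega(log n)).

    On the other hand, with constant probability the rows of V_bin at the y's, and
    those at the z's, form invertible D x D matrices, and then the kernel indicator
    restricts to a permutation matrix of rank 2^D: a proper subspace of codimension c
    contains a fraction at most 2^-c + k/n of the rows, and Dk/n tends to 0 because
    delta < 1/2. *)

Require Import Defs.
From Stdlib Require List.
From mathcomp Require Import all_boot all_order all_algebra all_field.
From mathcomp Require Import mxabelem.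
From mathcomp Require Import zify ring lra.
From mathcomp.multinomials Require mpoly.

Set Implicit Arguments.
Unset Strict Implicit.
Unset Printing Implicit Defensive.

Import Order.TTheory GRing.Theory Num.Theory.
Local Open Scope ring_scope.

(** * Decomposition of multilinear formulas *)

Section Variables.
Import mpoly.
Variables (K : idomainType) (N : nat).
Implicit Types (p q : {mpoly K[N]}) (i : 'I_N).

Definition mvars p : {set 'I_N} :=
  [set i | has (fun m : 'X_{1..N} => m i != 0) (msupp p)].

Lemma mvarsP p i :
  reflect (exists2 m : 'X_{1..N}, m \in msupp p & m i != 0) (i \in mvars p).
Proof. by rewrite inE; apply: hasP. Qed.

Lemma mvarsC c : mvars c%:MP = set0.
Proof.
apply/setP=> i; rewrite !inE msuppC; case: eqP => //= _.
by rewrite mnm0E.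
Qed.

Lemma mvarsX i : mvars 'X_i = [set i].
Proof.
apply/setP=> j; rewrite !inE msuppX /= orbF mnm1E [j == i]eq_sym.
by case: (i == j).
Qed.

Lemma mvarsM p q : mvars (p * q) \subset mvars p :|: mvars q.
Proof.
apply/subsetP=> i /mvarsP[m /msuppM_le /allpairsP[[m1 m2] /= [m1p m2q ->]]].
rewrite mnmDE addn_eq0 negb_and in_setU => /orP[m1i | m2i]; apply/orP.
  by left; apply/mvarsP; exists m1.
by right; apply/mvarsP; exists m2.
Qed.

Lemma meval_mvars p (x y : 'I_N -> K) :
  {in mvars p, x =1 y} -> p.@[x] = p.@[y].
Proof.
move=> xy; rewrite !mevalE; apply: eq_big_seq => m mp; congr (_ * _).
apply: eq_bigr => i _; have [-> //|mi] := eqVneq (m i) 0.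
by rewrite xy //; apply/mvarsP; exists m.
Qed.

(* Multiplies X_i by a fresh variable, whose exponent then records the degree in
   X_i; degrees add up under products since the coefficients form a domain. *)
Definition mark i p : {poly {mpoly K[N]}} :=
  mmap (polyC \o @mpolyC N K)
    (fun j => ('X_j : {mpoly K[N]})%:P * 'X^(j == i)) p.

Lemma markM i p q : mark i (p * q) = mark i p * mark i q.
Proof. exact: rmorphM. Qed.

Lemma coef_mark i p e (m : 'X_{1..N}) :
  ((mark i p)`_e)@_m = if m i == e then p@_m else 0.
Proof.
have -> : mark i p = \sum_(m' <- msupp p) (p@_m' *: 'X_[m'])%:P * 'X^(m' i).
  rewrite /mark /mmap; apply: eq_bigr => m' _.
  rewrite /= -mul_mpolyC rmorphM /= -mulrA; congr (_ * _).
  rewrite /mmap1 (eq_bigr (fun j => ('X_j ^+ m' j)%:P * 'X^((j == i) * m' j))).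
    rewrite big_split /= -rmorph_prod -mpolyXE_id; congr (_ * _).
    rewrite (bigD1 i) //= eqxx mul1n big1 ?mulr1 // => j /negPf->.
    by rewrite mul0n expr0.
  by move=> j _; rewrite exprMn rmorphXn -exprM.
rewrite coef_sum linear_sum /=.
under eq_bigr => m' _ do rewrite coefCM coefXn mulr_natr mcoeffMn mcoeffZ mcoeffX.
have [mp|mp] := boolP (m \in msupp p).
  rewrite (bigD1_seq m) ?msupp_uniq //= eqxx mulr1 eq_sym big1.
    by rewrite addr0; case: eqP.
  by move=> m' /negPf->; rewrite mulr0 mul0rn.
rewrite big1_seq => [|m' /= m'p].
  by rewrite (memN_msupp_eq0 mp) if_same.
by case: eqP m'p => [->|]; rewrite ?(negPf mp) // mulr0 mul0rn.
Qed.

Lemma size_mark i p : i \in mvars p -> (1 < size (mark i p))%N.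
Proof.
case/mvarsP=> m mp mi; rewrite (@leq_ltn_trans (m i)) ?lt0n //.
rewrite ltnNge; apply/negP=> /leq_sizeP /(_ _ (leqnn _)) /(congr1 (mcoeff m)).
by rewrite coef_mark eqxx mcoeff0 => /eqP; apply/negP; rewrite -mcoeff_msupp.
Qed.

(** If both factors contained [X_i], their images under [mark i] would have positive degree, so the
    product would have a nonzero leading coefficient at an exponent of at least 2. *)
Lemma mvars_disjoint p q :
  multilinear_poly (p * q) -> [disjoint mvars p & mvars q].
Proof.
move=> /allP ml; rewrite disjoint_subset; apply/subsetP=> i ip.
rewrite inE; apply/negP=> iq.
have [sp sq] := (size_mark ip, size_mark iq).
have p0 : mark i p != 0 by rewrite -size_poly_gt0 (ltn_trans _ sp).
have q0 : mark i q != 0 by rewrite -size_poly_gt0 (ltn_trans _ sq).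
have spq : (2 < size (mark i (p * q)))%N.
  rewrite markM (size_mul p0 q0) -ltnS.
  have sz : (3 < size (mark i p) + size (mark i q))%N := leq_add sp sq.
  by rewrite (ltn_predK sz).
have : lead_coef (mark i (p * q)) != 0.
  by rewrite markM lead_coef_eq0; exact: mulf_neq0 p0 q0.
rewrite lead_coefE => /eqP; apply; apply/mpolyP=> m.
rewrite coef_mark mcoeff0; case: eqP => // mi.
apply/eqP; rewrite mcoeff_eq0; apply/negP=> /ml /forallP /(_ i).
by rewrite mi; case: (size _) spq => [|[|[|a]]].
Qed.

End Variables.

Section Decomposition.
Variables (K : idomainType) (N : nat).
Implicit Types (F : formula K N) (U X : {set 'I_N}) (x y : cube N).
Local Open Scope nat_scope.

Definition restrict U x : cube N := [ffun i => (i \in U) && x i].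

(** Zeroing the variables outside [U] makes the value depend on [U] only, which allows induction on
    the set; for the full set it is the formula's own value. *)
Definition feval F U x : K :=
  mpoly.meval (fun i => (restrict U x i)%:R) (formula_poly F).

Definition fvars F : {set 'I_N} := mvars (formula_poly F).

Definition depends_on U (g : cube N -> K) :=
  forall x y, {in U, x =1 y} -> g x = g y.

Lemma depends_onS U X g : U \subset X -> depends_on U g -> depends_on X g.
Proof. by move=> /subsetP UX gU x y xy; apply: gU => i /UX /xy. Qed.

Lemma depends_onM U g h :
  depends_on U g -> depends_on U h -> depends_on U (fun x => g x * h x)%R.
Proof. by move=> gU hU x y xy; rewrite (gU _ _ xy) (hU _ _ xy). Qed.

Lemma feval_depends F U : depends_on U (feval F U).
Proof.
move=> x y xy; apply: mpoly.meval_eq => i; rewrite !ffunE.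
by case: (boolP (i \in U)) => [/xy ->|].
Qed.

Lemma feval_vars F U X : U :&: fvars F = X :&: fvars F -> feval F U =1 feval F X.
Proof.
move=> /setP UX x; apply: meval_mvars => i iF; rewrite !ffunE.
by have := UX i; rewrite !inE; rewrite inE in iF; rewrite iF !andbT => ->.
Qed.

(* A term stands for the product of its first t.+1 functions; sets are attached
   to indices beyond t as well, but those are irrelevant. *)
Definition term : Type := ((nat -> {set 'I_N}) * (nat -> cube N -> K))%type.

Definition log_product t X (T : term) : Prop :=
  [/\ forall j, j <= t -> T.1 j \subset X,
      forall j, j <= t -> #|X| <= 3 ^ t * #|T.1 j|,
      forall j, j <= t -> depends_on (T.1 j) (T.2 j)
    & forall i j, i < j -> j <= t -> [disjoint T.1 i & T.1 j]].

Definition term_eval t (T : term) x : K := (\prod_(j < t.+1) T.2 j x)%R.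

Definition decomposable t X s (f : cube N -> K) :=
  exists ts : seq term, [/\ size ts <= s, List.Forall (log_product t X) ts
    & forall x, f x = (\sum_(T <- ts) term_eval t T x)%R].

Lemma formula_size_gt0 F : 0 < formula_size F.
Proof. by elim: F => //= A + B _; rewrite addn_gt0 => ->. Qed.

Lemma subset_between U X a : U \subset X -> #|U| <= a <= #|X| ->
  exists W : {set 'I_N}, [/\ U \subset W, W \subset X & #|W| = a].
Proof.
move=> UX /andP[Ua aX]; elim: a Ua aX => [|a IH] Ua aX.
  by exists U; split=> //; apply/eqP; rewrite -leqn0.
move: Ua; rewrite leq_eqVlt => /orP[/eqP<-|Ua]; first by exists U.
have [W [UW WX Wa]] := IH Ua (ltnW aX).
have : W \proper X by rewrite properEcard WX Wa.
case/properP=> _ [i iX iW]; exists (i |: W); split.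
- exact: subset_trans UW (subsetUr _ _).
- by rewrite subUset sub1set iX.
- by rewrite cardsU1 iW Wa.
Qed.

(* (W, g, T) stands for g * T, where g collects the factors split off outside W. *)
Definition split_term t X U (r : {set 'I_N} * (cube N -> K) * term) : Prop :=
  [/\ r.1.1 \subset U, #|X| <= 3 * #|r.1.1|, 3 * #|r.1.1| <= 2 * #|X|,
      depends_on (U :\: r.1.1) r.1.2 & log_product t r.1.1 r.2].

(** [X] stays the yardstick for sizes, while [U] shrinks at the product gates during the descent
    through the formula. *)
Definition splittable t X U s (f : cube N -> K) :=
  exists rs, [/\ size rs <= s, List.Forall (split_term t X U) rs
    & forall x, f x = (\sum_(r <- rs) r.1.2 x * term_eval t r.2 x)%R].

Lemma splittableD t X U s1 s2 f1 f2 :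
    splittable t X U s1 f1 -> splittable t X U s2 f2 ->
  splittable t X U (s1 + s2) (fun x => f1 x + f2 x)%R.
Proof.
case=> r1 [s1r F1 E1] [r2 [s2r F2 E2]]; exists (r1 ++ r2); split.
- by rewrite size_cat leq_add.
- exact/List.Forall_app.
- by move=> x; rewrite big_cat E1 E2.
Qed.

(** [g] is absorbed into the split-off factors: it lives outside [U'], hence outside every [W]. *)
Lemma splittableM t X U U' s f g :
    splittable t X U' s f -> U' \subset U -> depends_on (U :\: U') g ->
  splittable t X U s (fun x => g x * f x)%R.
Proof.
case=> rs [srs Frs Ers] U'U gU.
exists [seq (r.1.1, fun x => g x * r.1.2 x, r.2)%R | r <- rs]; split.
- by rewrite size_map.
- apply/List.Forall_map; apply: List.Forall_impl Frs => -[[W h] T] /=.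
  case=> /= WU' XW WX hW TW; split=> //=.
    exact: subset_trans WU' U'U.
  apply: depends_onM.
    by apply: depends_onS gU; rewrite setDS.
  by apply: depends_onS hW; rewrite setSD.
- by move=> x; rewrite Ers mulr_sumr big_map; apply: eq_bigr => r _; rewrite mulrA.
Qed.

Lemma splittable_ext t X U s f g : f =1 g ->
  splittable t X U s f -> splittable t X U s g.
Proof. by move=> fg [rs [srs Frs Ers]]; exists rs; split=> // x; rewrite -fg. Qed.

(** All visible variables fit into one set [W] of size between a third and two thirds of [X], so
    nothing is split off (the factor is 1) and the decomposition over [W] does the rest. *)
Lemma splittable_small t X U F :
    (forall W : {set 'I_N}, 2 * 3 ^ t <= #|W| ->
       decomposable t W (formula_size F) (feval F W)) ->
    2 * 3 ^ t.+1 <= #|X| -> #|X| <= 3 * #|U| ->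
    3 * #|U :&: fvars F| <= 2 * #|X| ->
  splittable t X U (formula_size F) (feval F U).
Proof.
move=> decF X3 XU small.
have X2 : 2 <= #|X|.
  by apply: leq_trans X3; rewrite -[X in X <= _]muln1 leq_mul // expn_gt0.
have [W [FW WU XW WX]] : exists W : {set 'I_N}, [/\ U :&: fvars F \subset W,
    W \subset U, #|X| <= 3 * #|W| & 3 * #|W| <= 2 * #|X|].
  have [lt|ge] := ltnP (3 * #|U :&: fvars F|) #|X|; last first.
    by exists (U :&: fvars F); split=> //; exact: subsetIl.
  have Xdiv := divn_eq (#|X| + 2) 3; have Xmod := ltn_pmod (#|X| + 2) (isT : 0 < 3).
  (* Too few visible variables are padded up to [|X| / 3] rounded up, which is at most [2 |X| / 3]
     because [|X|] is at least 2. *)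
  have [||W [? ? Wa]] := @subset_between (U :&: fvars F) U ((#|X| + 2) %/ 3).
  - exact: subsetIl.
  - apply/andP; split; first rewrite leq_divRL // mulnC.
      exact: leq_trans (ltnW lt) (leq_addr _ _).
    by rewrite -ltnS ltn_divLR // mulSn mulnC addnC ltn_add2l.
  exists W; split=> //; rewrite Wa mulnC.
    by rewrite -(leq_add2r 2) {1}Xdiv leq_add2l.
  by apply: leq_trans (leq_trunc_div _ _) _; rewrite mul2n -addnn leq_add2l.
have [ts [sts Fts Ets]] : decomposable t W (formula_size F) (feval F W).
  apply: decF; rewrite -(@leq_pmul2l 3) //; apply: leq_trans XW.
  by rewrite mulnCA -expnS.
exists [seq (W, fun=> 1%R, T) | T <- ts]; split.
- by rewrite size_map.
- by apply/List.Forall_map; apply: List.Forall_impl Fts => T TW; split.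
- move=> x; rewrite big_map (@feval_vars F U W).
    by rewrite Ets; apply: eq_bigr => T _; rewrite mul1r.
  by apply/eqP; rewrite eqEsubset subsetI FW subsetIr setSI.
Qed.

(* Descends to the child with more variables in U until it has at most 2/3 of X. *)
Lemma formula_split t X F U :
    (forall G (W : {set 'I_N}), multilinear_formula G -> 2 * 3 ^ t <= #|W| ->
       decomposable t W (formula_size G) (feval G W)) ->
    multilinear_formula F ->
    2 * 3 ^ t.+1 <= #|X| -> #|X| <= 3 * #|U| ->
  splittable t X U (formula_size F) (feval F U).
Proof.
move=> dec; move=> MF X3 XU; elim: F U MF XU => [c|i|A IA B IB|A IA B IB] U MF XU;
  match goal with |- splittable _ _ _ (formula_size ?F) _ =>
    have [small|large] := leqP (3 * #|U :&: fvars F|) (2 * #|X|);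
    [by apply: splittable_small => // W; exact: dec|]
  end.
(* A leaf sees at most one variable, too few to exceed two thirds of [X], so both leaf cases are
   void. *)
- by move: large; rewrite /fvars mvarsC setI0 cards0.
- have : #|U :&: fvars (Var K i)| <= 1.
    by rewrite /fvars mvarsX -(cards1 i) subset_leq_card // subsetIr.
  have := expn_gt0 3 t; move: X3 large; rewrite expnS /=; lia.
(* At a sum both children are descended with the same [U]; the numbers of terms add up like the
   sizes. *)
- move: MF => /= /and3P[_ MA MB].
  apply: splittable_ext (splittableD (IA U MA XU) (IB U MB XU)) => x.
  by rewrite /feval /= mpoly.mevalD.
- move: MF => /= /and3P[ml MA MB].
  have dAB := mvars_disjoint ml.
  have gen G H : [disjoint fvars G & fvars H] -> #|X| <= 3 * #|U :&: fvars G| ->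
      splittable t X (U :&: fvars G) (formula_size G) (feval G (U :&: fvars G)) ->
      splittable t X U (formula_size G + formula_size H)
        (fun x => feval H U x * feval G U x)%R.
    move=> dGH XG /(@splittableM _ _ U _ _ _ (feval H U)) /=.
    case.
    + exact: subsetIl.
    + apply: (@depends_onS (U :&: fvars H)).
        rewrite setDE setCI setIUr setICr set0U setIS //.
        by rewrite -disjoints_subset disjoint_sym.
      have E := @feval_vars H U (U :&: fvars H).
      move=> x y xy; rewrite !E -?setIA ?setIid //.
      exact: feval_depends.
    + move=> rs [srs Frs Ers]; exists rs; split=> //.
        exact: leq_trans srs (leq_addr _ _).
      move=> x; rewrite -Ers; congr (_ * _)%R.
      by apply: feval_vars; rewrite -setIA setIid.
  have [leA|ltA] := leqP #|X| (3 * #|U :&: fvars A|).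
    apply: splittable_ext (gen A B dAB leA (IA _ MA leA)) => x.
    by rewrite mulrC /feval /= mpoly.mevalM.
  (* More than two thirds are visible to the product and less than one third to [A], so [B] sees at
     least a third. *)
  have leB : #|X| <= 3 * #|U :&: fvars B|.
    have sub : U :&: fvars (Mul A B) \subset (U :&: fvars A) :|: (U :&: fvars B).
      by rewrite -setIUr setIS // mvarsM.
    have := leq_trans (subset_leq_card sub) (leq_card_setU _ _).
    by move: large ltA; lia.
  rewrite addnC; rewrite disjoint_sym in dAB.
  apply: splittable_ext (gen B A dAB leB (IB _ MB leB)) => x.
  by rewrite /feval /= mpoly.mevalM.
Qed.

(** Each level splits one factor off every term and applies induction to the remaining set [W],
    which keeps at least a third of [X]. *)
Lemma formula_decomposition t F X :
    multilinear_formula F -> 2 * 3 ^ t <= #|X| ->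
  decomposable t X (formula_size F) (feval F X).
Proof.
elim: t F X => [|t IH] F X MF X3.
  exists [:: (fun=> X, fun=> feval F X)]; split; first exact: formula_size_gt0.
    constructor=> //; split=> //= [j _|j _|i [|j]] //; first by rewrite mul1n.
    exact: feval_depends.
  by move=> x; rewrite big_seq1 /term_eval big_ord1.
have XX : #|X| <= 3 * #|X| by rewrite leq_pmull.
have [rs [srs Frs Ers]] := formula_split IH MF X3 XX.
(* The split-off factor becomes factor 0 with the set [X :\: W], which holds at least a third of [X]
   since [W] holds at most two thirds. *)
pose cons (r : {set 'I_N} * (cube N -> K) * term) : term :=
  (fun j => if j is j'.+1 then r.2.1 j' else X :\: r.1.1,
   fun j => if j is j'.+1 then r.2.2 j' else r.1.2).
exists (map cons rs); split; first by rewrite size_map.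
  apply/List.Forall_map; apply: List.Forall_impl Frs => -[[W g] T] /=.
  case=> /= WX XW W2 gW [TW Tc Td Tdis]; split=> /=.
  - case=> [_|j /TW TjW]; first exact: subsetDl.
    exact: subset_trans WX.
  - case=> [_|j /Tc Wj].
      rewrite cardsDS // (@leq_trans (3 * (#|X| - #|W|))) //.
        rewrite mulnBr -(leq_add2r (3 * #|W|)) subnK ?leq_mul2l ?subset_leq_card //.
        by rewrite mulSn leq_add2l.
      by rewrite leq_mul2r -{1}[3]expn1 leq_exp2l ?orbT.
    by rewrite expnS -mulnA (leq_trans XW) // leq_mul2l.
  - by case=> [_|j /Td].
  - case=> [|i] [|j] //= ij jt; last exact: Tdis.
    rewrite disjoint_sym disjoints_subset setCD.
    by rewrite (subset_trans (TW _ jt)) // subsetUr.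
move=> x; rewrite Ers big_map; apply: eq_bigr => r _.
by rewrite [RHS]big_ord_recl.
Qed.

End Decomposition.

(** * Separation rank *)

Section SeparationRank.
Variable K : fieldType.

(** This is matrix rank at most [r], expressed through rank-one summands so that products and sums
    of functions are handled directly. *)
Definition sep_rank_le (Y Z : finType) (r : nat) (F : Y -> Z -> K) :=
  exists l : seq ((Y -> K) * (Z -> K)),
    (size l <= r)%N /\ forall y z, F y z = \sum_(p <- l) p.1 y * p.2 z.

Lemma sep_rank_le_ext (Y Z : finType) r (F G : Y -> Z -> K) :
  (forall y z, F y z = G y z) -> sep_rank_le r F -> sep_rank_le r G.
Proof. by move=> FG [l [lr Fl]]; exists l; split=> // y z; rewrite -FG. Qed.

Lemma sep_rank_le_mul (Y Z : finType) r1 r2 (F1 F2 : Y -> Z -> K) :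
    sep_rank_le r1 F1 -> sep_rank_le r2 F2 ->
  sep_rank_le (r1 * r2) (fun y z => F1 y z * F2 y z).
Proof.
case=> l1 [lr1 E1] [l2 [lr2 E2]].
exists [seq (fun y => p.1 y * q.1 y, fun z => p.2 z * q.2 z) | p <- l1, q <- l2].
split=> [|y z]; first by rewrite size_allpairs leq_mul.
rewrite big_allpairs_dep E1 E2 mulr_suml; apply: eq_bigr => p _.
by rewrite mulr_sumr; apply: eq_bigr => q _ /=; rewrite mulrACA.
Qed.

Lemma sep_rank_le_prod (Y Z : finType) t (r : nat -> nat) (F : nat -> Y -> Z -> K) :
    (forall j, (j <= t)%N -> sep_rank_le (2 ^ r j) (F j)) ->
  sep_rank_le (2 ^ (\sum_(j < t.+1) r j)) (fun y z => \prod_(j < t.+1) F j y z).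
Proof.
elim: t => [|t IH] rF.
  rewrite big_ord1; apply: sep_rank_le_ext (rF 0 _) => // y z.
  by rewrite big_ord1.
rewrite big_ord_recr expnD.
apply: sep_rank_le_ext (sep_rank_le_mul (IH _) (rF t.+1 _)) => // [y z|j jt].
  by rewrite [RHS]big_ord_recr.
by apply: rF; rewrite leqW.
Qed.

Lemma sep_rank_le_sum (Y Z : finType) (I : Type) (P : I -> Prop) (ts : seq I)
    (r : I -> nat) (F : I -> Y -> Z -> K) :
    List.Forall P ts -> (forall i, P i -> sep_rank_le (r i) (F i)) ->
  sep_rank_le (\sum_(i <- ts) r i) (fun y z => \sum_(i <- ts) F i y z).
Proof.
move=> Pts rF; elim: Pts => [|i {}ts Pi _ [l [lr E]]].
  by exists [::]; split=> [|y z]; rewrite !big_nil.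
have [l' [lr' E']] := rF i Pi; exists (l' ++ l); split=> [|y z].
  by rewrite size_cat big_cons leq_add.
by rewrite big_cat big_cons E E'.
Qed.

(** Reindexed along the two bijections, the function is the identity matrix of order [#|W|]; the
    separation factors it through dimension [size l]. *)
Lemma sep_rank_le_bij (W Y Z : finType) r (a : Y -> W) (b : Z -> W) :
    bijective a -> bijective b ->
    sep_rank_le r (fun y z => (a y == b z)%:R) ->
  (#|W| <= r)%N.
Proof.
case=> a' a'K aK [b' b'K bK] [l [lr E]].
pose d : (Y -> K) * (Z -> K) := (fun=> 0, fun=> 0).
pose A := \matrix_(i < #|W|, p < size l) (nth d l p).1 (a' (enum_val i)).
pose B := \matrix_(p < size l, j < #|W|) (nth d l p).2 (b' (enum_val j)).
have AB : A *m B = 1%:M.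
  apply/matrixP=> i j; rewrite !mxE.
  rewrite (_ : (i == j) = (a (a' (enum_val i)) == b (b' (enum_val j)))).
    rewrite E (big_nth d) big_mkord; apply: eq_bigr => p _.
    by rewrite !mxE.
  by rewrite aK bK (inj_eq enum_val_inj).
by apply: leq_trans lr; rewrite -(mxrank1 K #|W|) -AB mulmx_max_rank.
Qed.

End SeparationRank.

(** * Rank of a decomposition under restriction to chosen variables *)

Section Assignments.
Variables (K : fieldType) (N m : nat) (u v : 'I_m -> 'I_N).
Implicit Types (y z : {set 'I_m}) (S X : {set 'I_N}).

(* Variables outside the images of u and v are set to 0. *)
Definition assignment y z : cube N :=
  [ffun i => (i \in u @: y) || (i \in v @: z)].

Definition balance S : nat := minn #|u @^-1: S| #|v @^-1: S|.

(** [g] notices of [y] only the part mapped into [S]. Summing over the possible values of that part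
    separates [y] from [z]; the same works for [z], and the side with fewer values is taken. *)
Lemma balance_rank S (g : cube N -> K) :
    depends_on S g ->
  sep_rank_le (2 ^ balance S) (fun y z => g (assignment y z)).
Proof.
move=> gS.
have memI (w : 'I_m -> 'I_N) y i : i \in S ->
    (i \in w @: y) = (i \in w @: (y :&: w @^-1: S)).
  move=> iS; apply/imsetP/imsetP=> [[l ly il]|[l]].
    by exists l; rewrite // !inE ly -il.
  by rewrite inE => /andP[ly _] il; exists l.
have size_pow (A : {set 'I_m}) : size (enum (powerset A)) = (2 ^ #|A|)%N.
  by rewrite -cardE card_powerset.
rewrite /balance; case: leqP => _.
  exists [seq (fun y => (y :&: u @^-1: S == w)%:R, fun z => g (assignment w z))
         | w <- enum (powerset (u @^-1: S))].
  split=> [|y z]; first by rewrite size_map size_pow.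
  rewrite big_map big_enum /= (bigD1 (y :&: u @^-1: S)) /=; last first.
    by rewrite inE subsetIr.
  rewrite eqxx mul1r big1 ?addr0 => [|w /andP[_ /negPf]]; last first.
    by rewrite eq_sym => ->; rewrite mul0r.
  by apply: gS => i iS; rewrite !ffunE memI.
exists [seq (fun y => g (assignment y w), fun z => (z :&: v @^-1: S == w)%:R)
       | w <- enum (powerset (v @^-1: S))].
split=> [|y z]; first by rewrite size_map size_pow.
rewrite big_map big_enum /= (bigD1 (z :&: v @^-1: S)) /=; last first.
  by rewrite inE subsetIr.
rewrite eqxx mulr1 big1 ?addr0 => [|w /andP[_ /negPf]]; last first.
  by rewrite eq_sym => ->; rewrite mulr0.
by apply: gS => i iS; rewrite !ffunE [in RHS]memI // [in LHS]memI // [i \in v @: z]memI.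
Qed.

Lemma decomposition_rank t X (ts : seq (term K N)) :
    List.Forall (log_product t X) ts ->
  sep_rank_le (\sum_(T <- ts) 2 ^ (\sum_(j < t.+1) balance (T.1 j)))
    (fun y z => \sum_(T <- ts) term_eval t T (assignment y z)).
Proof.
move=> Fts; apply: (sep_rank_le_sum Fts) => T [_ _ dep _].
pose F j y z := T.2 j (assignment y z).
apply: (@sep_rank_le_prod K _ _ t (fun j => balance (T.1 j)) F) => j jt.
exact/balance_rank/dep.
Qed.

End Assignments.

(** * Random walks *)

Section Expectation.
Variables (R : realFieldType) (T : finType).
Implicit Types (F G : seq T -> R) (L : nat).

(* The mean of F over L independent uniform elements of T; 0 if T is empty and L > 0. *)
Fixpoint Ex L F : R :=
  if L is L'.+1 then (\sum_x Ex L' (fun s => F (x :: s))) / #|T|%:R else F [::].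

Lemma Ex_le L F G : (forall s, size s = L -> F s <= G s) -> Ex L F <= Ex L G.
Proof.
elim: L F G => [|L IH] F G FG /=; first exact: FG.
rewrite ler_wpM2r ?invr_ge0 ?ler0n // ler_sum // => x _.
by apply: IH => s sL; apply: FG; rewrite /= sL.
Qed.

Lemma Ex_eq L F G : (forall s, size s = L -> F s = G s) -> Ex L F = Ex L G.
Proof.
by move=> FG; apply/eqP; rewrite eq_le; apply/andP; split; apply: Ex_le => s /FG ->.
Qed.

Lemma ExD L F G : Ex L (fun s => F s + G s) = Ex L F + Ex L G.
Proof.
elim: L F G => //= L IH F G; rewrite -mulrDl -big_split; congr (_ / _).
by apply: eq_bigr => x _; rewrite IH.
Qed.

Lemma ExZ L a F : Ex L (fun s => a * F s) = a * Ex L F.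
Proof.
elim: L F => //= L IH F; rewrite mulrA mulr_sumr; congr (_ / _).
by apply: eq_bigr => x _; rewrite IH.
Qed.

Lemma Ex_cst L a : (0 < #|T|)%N -> Ex L (fun=> a) = a.
Proof.
move=> T0; elim: L => //= L ->; rewrite sumr_const -[a *+ _]mulr_natr.
by rewrite mulfK // pnatr_eq0 -lt0n.
Qed.

Lemma Ex_sum (I : Type) (r : seq I) L (F : I -> seq T -> R) :
  Ex L (fun s => \sum_(i <- r) F i s) = \sum_(i <- r) Ex L (F i).
Proof.
elim: r => [|i r IH].
  rewrite big_nil -[RHS](mul0r (Ex L (fun=> 0))) -ExZ.
  by apply: Ex_eq => s _; rewrite big_nil mul0r.
by rewrite big_cons -IH -ExD; apply: Ex_eq => s _; rewrite big_cons.
Qed.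

(** Exchanges the order of averaging: the tail is drawn first, so that a new element can be examined
    given the others. *)
Lemma ExS L F :
  Ex L.+1 F = Ex L (fun s => (\sum_x F (x :: s)) / #|T|%:R).
Proof.
rewrite /= mulrC; under [RHS]Ex_eq => s _ do rewrite mulrC.
by rewrite ExZ Ex_sum.
Qed.

End Expectation.

Lemma Ex_pair (R : realFieldType) (T1 T2 : finType) L
    (F : seq T1 -> R) (G : seq T2 -> R) :
  Ex L (fun s : seq (T1 * T2) => F (unzip1 s) * G (unzip2 s)) = Ex L F * Ex L G.
Proof.
elim: L F G => //= L IH F G.
rewrite card_prod natrM invfM mulrACA; congr (_ * _).
rewrite mulr_suml (eq_bigr (fun x1 => \sum_x2
  Ex L (fun s => F (x1 :: s)) * Ex L (fun s => G (x2 :: s)))).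
  rewrite pair_big /=; apply: eq_bigr => -[x1 x2] _.
  exact: (IH (fun s => F (x1 :: s)) (fun s => G (x2 :: s))).
by move=> x1 _; rewrite mulr_sumr.
Qed.

(** Weierstrass's product inequality. It lets the mutually exclusive events of one walk step be
    compared with independent ones. *)
Lemma one_minus_sum_le_prod (R : realDomainType) (I : Type) (r : seq I) (a : I -> R) :
    (forall i, 0 <= a i <= 1) ->
  1 - \sum_(i <- r) a i <= \prod_(i <- r) (1 - a i).
Proof.
move=> a01; have p01 l : 0 <= \prod_(i <- l) (1 - a i) <= 1.
  elim: l => [|i l IH]; rewrite ?big_nil ?ler01 ?lexx // big_cons.
  by have := a01 i; nra.
elim: r => [|i r IH]; first by rewrite !big_nil subr0.
by rewrite !big_cons; have := a01 i; have := p01 r; nra.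
Qed.

Section Walk.
Variables (R : realFieldType) (I : finType) (color : I -> nat) (tau : nat).
(** [H M] is the potential [H 0] averaged over [M] fair steps of length one. A bound with a
    geometric term in [M] is easily averaged when the number of fair steps is random. *)
Variables (H : nat -> int -> R) (eps w : R).
Hypotheses (H_ge0 : forall M x, 0 <= H M x)
  (H_avg : forall M x, H M (x + 1) + H M (x - 1) = 2 * H M.+1 x)
  (H_le : forall M x, H M x <= eps + w / 2 ^+ M)
  (eps_gt0 : 0 < eps) (w_ge0 : 0 <= w).

Definition class i : {set I} := [set x | color x == i].

Definition drift (j : nat) (p : I * I) : int :=
  (color p.1 == j.*2)%:R - (color p.2 == j.*2)%:R.

Definition drift_sum j (s : seq (I * I)) : int := \sum_(p <- s) drift j p.

(* Half the probability that a uniform pair has colors 2j and 2j+1 in some order. *)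
Definition meet j : R := (#|class j.*2| * #|class j.*2.+1|)%:R / (#|I| ^ 2)%:R.

Let walk L (M : 'I_tau -> nat) (c : 'I_tau -> int) : R :=
  Ex L (fun s => \prod_(j < tau) H (M j) (c j + drift_sum j s)).

(** A pair has colors 2j and 2j+1 with probability [2 * meet j] and then halves the decaying term of
    coordinate [j], so a step costs that term a factor [1 - meet j]. The product treats the
    coordinates as if they were independent. *)
Let bound L (M : 'I_tau -> nat) : R :=
  \prod_(j < tau) (eps + w / 2 ^+ M j * (1 - meet j) ^+ L).

Let unit (j i : 'I_tau) : nat := (i == j).

Lemma walk_avg L M c j :
  walk L M (fun i => c i + (unit j i)%:Z) + walk L M (fun i => c i - (unit j i)%:Z) =
  2 * walk L (fun i => M i + unit j i)%N c.
Proof.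
rewrite -ExD -ExZ; apply: Ex_eq => s _.
have D1 (f : 'I_tau -> R) : \prod_i f i = f j * \prod_(i | i != j) f i.
  by rewrite (bigD1 j).
rewrite !D1 /unit eqxx addn1 mulrA -H_avg mulrDl.
congr (H _ _ * _ + H _ _ * _); try by rewrite addrAC.
  by apply: eq_bigr => i /negPf ->; rewrite addn0 addr0.
by apply: eq_bigr => i /negPf ->; rewrite addn0 subr0.
Qed.

Lemma meet_ge0 j : 0 <= meet j.
Proof. by rewrite divr_ge0 ?ler0n. Qed.

Lemma meet_le1 j : meet j <= 1.
Proof.
have [I0|I0] := posnP #|I|; first by rewrite /meet I0 invr0 mulr0 ler01.
rewrite ler_pdivrMr ?ltr0n ?expn_gt0 ?I0 // mul1r ler_nat.
by rewrite expnS expn1 leq_mul // max_card.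
Qed.

(* Pairs of colors 2j and 2j+1 move only the j-th coordinate, by +1 and -1 equally
   often, and so replace H M by H M.+1 there; all other pairs merely shift c. *)
Lemma walk_step L M c :
    (0 < #|I|)%N -> (forall M' c', walk L M' c' <= bound L M') ->
  walk L.+1 M c <= bound L.+1 M.
Proof.
move=> I0 IH; pose Q j : R := (#|class j.*2| * #|class j.*2.+1|)%:R.
pose up j := walk L M (fun i => c i + (unit j i)%:Z).
pose dn j := walk L M (fun i => c i - (unit j i)%:Z).
pose B := bound L M.
have walkE : walk L.+1 M c =
    (\sum_p walk L M (fun i => c i + drift i p)) / #|{: I * I}|%:R.
  rewrite /walk /=; congr (_ / _); apply: eq_bigr => p _.
  apply: Ex_eq => s _; apply: eq_bigr => j _; congr (H _ _).
  by rewrite /drift_sum big_cons addrA.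
have walk_ext c1 c2 : c1 =1 c2 -> walk L M c1 = walk L M c2.
  by move=> e; apply: Ex_eq => s _; apply: eq_bigr => j _; rewrite e.
(* At most one [j] can match the colors of [p]; then the right side is exactly [up j] or [dn j].
   Otherwise it is [B], the bound given by induction. *)
have pointwise p : walk L M (fun i => c i + drift i p) <=
    B + \sum_(j < tau) (((p.1 \in class j.*2) && (p.2 \in class j.*2.+1))%:R * (up j - B)
      + ((p.1 \in class j.*2.+1) && (p.2 \in class j.*2))%:R * (dn j - B)).
  have [/existsP[j]|none] := boolP [exists j : 'I_tau,
      ((p.1 \in class j.*2) && (p.2 \in class j.*2.+1))
      || ((p.1 \in class j.*2.+1) && (p.2 \in class j.*2))].
    rewrite (bigD1 j) //= !inE => col.
    rewrite [X in B + (_ + X)]big1 => [|i ij]; last first.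
      have {}ij : (i : nat) <> j by move=> /val_inj e; rewrite e eqxx in ij.
      rewrite !inE; case/orP: col => /andP[/eqP-> /eqP->].
        have -> : (j.*2 == i.*2) = false by lia.
        have -> : (j.*2 == i.*2.+1) = false by lia.
        by rewrite !mul0r addr0.
      have -> : (j.*2 == i.*2) = false by lia.
      by rewrite andbF (_ : (j.*2.+1 == i.*2) = false) ?mul0r ?addr0 //; lia.
    case/orP: col => /andP[/eqP c1 /eqP c2]; rewrite c1 c2 !eqxx /=.
      have -> : (j.*2 == j.*2.+1) = false by lia.
      rewrite mul1r mul0r !addr0 addrC subrK le_eqVlt; apply/orP; left; apply/eqP.
      apply: walk_ext => i; congr (_ + _); rewrite /drift c1 c2 /unit -val_eqE /=.
      have -> : (j.*2 == i.*2) = (i == j :> nat) by lia.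
      have -> : (j.*2.+1 == i.*2) = false by lia.
      by rewrite subr0; case: (_ == _).
    have -> : (j.*2.+1 == j.*2) = false by lia.
    rewrite mul1r mul0r addr0 add0r addrC subrK le_eqVlt; apply/orP; left; apply/eqP.
    apply: walk_ext => i; congr (_ + _); rewrite /drift c1 c2 /unit -val_eqE /=.
    have -> : (j.*2 == i.*2) = (i == j :> nat) by lia.
    have -> : (j.*2.+1 == i.*2) = false by lia.
    by rewrite sub0r; case: (_ == _).
  rewrite big1 ?addr0 ?IH // => j _; move/existsPn: none => /(_ j).
  by rewrite negb_or => /andP[/negPf-> /negPf->]; rewrite !mul0r addr0.
have w0 j : 0 <= w / 2 ^+ M j * (1 - meet j) ^+ L.
  by rewrite mulr_ge0 ?divr_ge0 ?exprn_ge0 ?subr_ge0 ?meet_le1.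
pose W j := w / 2 ^+ M j * (1 - meet j) ^+ L.
(* The relative loss of the factor [eps + W j] when [W j] is halved. *)
pose x j := W j / 2 / (eps + W j).
have W0 j : 0 < eps + W j by rewrite ltr_wpDr ?w0.
have updn j : up j + dn j - 2 * B <= - (2 * x j * B).
  rewrite /up /dn walk_avg; have := IH (fun i => M i + unit j i)%N c.
  have -> : bound L (fun i => M i + unit j i)%N = (1 - x j) * B.
    rewrite /B /bound (bigD1 j) //= [X in _ = _ * X](bigD1 j) //=.
    rewrite /unit eqxx mulrA; congr (_ * _).
      rewrite /x -/(W j) addn1 exprSr invfM mulrA [_ / 2 * _]mulrAC -/(W j).
      by field; rewrite gt_eqF ?W0 // pnatr_eq0.
    by apply: eq_bigr => i /negPf->; rewrite addn0.
  by move: (walk _ _ _) => y; lra.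
have I2 : 0 < #|{: I * I}|%:R :> R by rewrite ltr0n card_prod muln_gt0 I0.
rewrite walkE ler_pdivrMr //; apply: le_trans (ler_sum _ (fun p _ => pointwise p)) _.
rewrite big_split /= sumr_const exchange_big /=.
have cardQ (j : 'I_tau) : \sum_p (((p.1 \in class j.*2) && (p.2 \in class j.*2.+1))%:R * (up j - B)
      + ((p.1 \in class j.*2.+1) && (p.2 \in class j.*2))%:R * (dn j - B)) =
    Q j * (up j + dn j - 2 * B).
  rewrite big_split /= -!mulr_suml.
  have cX (C D : {set I}) :
      \sum_(p : I * I) ((p.1 \in C) && (p.2 \in D))%:R = (#|C| * #|D|)%:R :> R.
    rewrite -cardsX -sum1_card natr_sum [RHS]big_mkcond; apply: eq_bigr => p _.
    by case: p => p1 p2; rewrite in_setX; case: (_ && _).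
  by rewrite !cX /Q [(#|class _.+1| * _)%N]mulnC; ring.
rewrite (eq_bigr _ (fun j _ => cardQ j)).
have I2E : #|{: I * I}|%:R = (#|I| ^ 2)%:R :> R by rewrite card_prod expnS expn1.
have QE (j : 'I_tau) : Q j = meet j * #|{: I * I}|%:R.
  by rewrite /meet -I2E mulfVK // gt_eqF.
have B0 : 0 <= B by apply: prodr_ge0 => j _; rewrite ltW ?W0.
have mid : B *+ #|xpredT : pred (I * I)| + \sum_(j < tau) Q j * (up j + dn j - 2 * B) <=
    B * (1 - \sum_(j < tau) (2 * meet j * x j)) * #|{: I * I}|%:R.
  rewrite (_ : #|xpredT : pred (I * I)| = #|{: I * I}|); last exact: eq_card.
  rewrite -[B *+ _]mulr_natr mulrBr mulr1 mulrBl lerD2l mulr_sumr mulr_suml.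
  rewrite -sumrN ler_sum // => j _.
  rewrite QE; have := ler_wpM2l (mulr_ge0 (meet_ge0 j) (ltW I2)) (updn j).
  by move/le_trans; apply; rewrite le_eqVlt; apply/orP; left; apply/eqP; ring.
apply: le_trans mid _; rewrite ler_wpM2r ?(ltW I2) //.
have x01 (j : 'I_tau) : 0 <= 2 * meet j * x j <= 1.
  have x0 : 0 <= x j by rewrite !divr_ge0 ?w0 // ltW ?W0.
  have x1 : x j <= 1 / 2.
    by rewrite /x ler_pdivrMr ?W0 //; have := W0 j; have := eps_gt0; rewrite /W; lra.
  by have := meet_ge0 j; have := meet_le1 j; nra.
(* Factor by factor, [(eps + W j) * (1 - 2 * meet j * x j)] equals [eps + W j * (1 - meet j)], as
   [bound L.+1] requires. *)
apply: le_trans (ler_wpM2l B0 (one_minus_sum_le_prod _ x01)) _.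
rewrite -big_split /= le_eqVlt; apply/orP; left; apply/eqP; apply: eq_bigr => j _.
rewrite exprSr [in RHS]mulrA -/(W j) /x.
by field; rewrite gt_eqF ?W0.
Qed.

Lemma walk_bound L :
    (0 < #|I|)%N ->
  Ex L (fun s => \prod_(j < tau) H 0 (drift_sum j s)) <=
    \prod_(j < tau) (eps + w * (1 - meet j) ^+ L).
Proof.
move=> I0; have gen M c : walk L M c <= bound L M.
  elim: L M c => [|L' IH] M c; last exact: walk_step.
  by apply: ler_prod => j _; rewrite H_ge0 mulr1 H_le.
have := gen (fun=> 0) (fun=> 0).
rewrite /bound; under [X in _ <= X -> _]eq_bigr => j _ do rewrite expr0 divr1.
by apply: le_trans; apply: Ex_le => s _; under [X in _ <= X]eq_bigr => j _ do rewrite add0r.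
Qed.

End Walk.

(** * Binomial estimates and smoothing of the rank loss *)

Lemma central_bin_le M : ('C(M.*2, M) ^ 2 * M.*2.+1 <= 16 ^ M)%N.
Proof.
elim: M => // M IH.
have e1 : (M.+1 * 'C(M.*2.+2, M.+1) = 2 * (M.*2.+1 * 'C(M.*2, M)))%N.
  have := mul_bin_diag M.*2.+2 M; have := mul_bin_down M.*2.+1 M.
  rewrite /= (_ : M.*2.+1 - M = M.+1)%N; last lia.
  by move: ('C(M.*2, M)) ('C(_, _)) ('C(_, _)) => a b c; nia.
rewrite doubleS -(@leq_pmul2l (M.+1 ^ 2)) // mulnA -expnMn e1.
(* Consecutive left sides have ratio [4 (2M+1)(2M+3) / (M+1)^2], and [(2M+1)(2M+3) <= 4 (M+1)^2]. *)
apply: (@leq_trans (4 * (M.*2.+1 * M.*2.+3) * ('C(M.*2, M) ^ 2 * M.*2.+1))).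
  by move: ('C(_, _)) => c; nia.
rewrite [(16 ^ M.+1)%N]expnS [X in (_ <= X)%N]mulnA; apply: leq_mul IH; nia.
Qed.

(** By Vandermonde's identity [C(2M, M)] is the sum of the squares [C(M, i)^2]. This covers both
    parities of [M], at the price of a fourth root in the final estimate. *)
Lemma sqr_bin_le M i : ('C(M, i) ^ 2 <= 'C(M.*2, M))%N.
Proof.
have [iM|Mi] := leqP i M; last by rewrite bin_small.
rewrite -addnn -binomial.Vandermonde (bigD1 (Ordinal (iM : i < M.+1)%N)) //=.
by rewrite bin_sub // -mulnn leq_addr.
Qed.

Section Smoothing.
Variable R : realFieldType.

(* 3/4 is a rational upper bound for 2^(-1/2). *)
Definition peak (x : int) : R := (3 / 4) ^+ `|x|%N.

Fixpoint smooth M (x : int) : R :=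
  if M is M'.+1 then (smooth M' (x + 1) + smooth M' (x - 1)) / 2 else peak x.

Lemma peak01 x : 0 <= peak x <= 1.
Proof. by rewrite exprn_ge0 ?exprn_ile1 //; lra. Qed.

Lemma smooth01 M x : 0 <= smooth M x <= 1.
Proof.
elim: M x => [|M IH] x /=; first exact: peak01.
by have := IH (x + 1); have := IH (x - 1); lra.
Qed.

Let walk_sum M x : R := \sum_(i < M.+1) 'C(M, i)%:R * peak (x + M%:Z - (2 * i)%:Z).

Let walk_sumS M x : walk_sum M (x + 1) + walk_sum M (x - 1) = walk_sum M.+1 x.
Proof.
have -> : walk_sum M (x + 1) =
    \sum_(i < M.+2) 'C(M, i)%:R * peak (x + 1 + M%:Z - (2 * i)%:Z).
  by rewrite big_ord_recr /= bin_small // mul0r addr0.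
rewrite big_ord_recl [RHS]big_ord_recl -addrA -big_split; congr (_ + _).
  by rewrite !bin0 !mul1r; congr peak; rewrite /=; lia.
apply: eq_bigr => i _; rewrite /= binS natrD mulrDl.
by congr (_ * peak _ + _ * peak _); rewrite /bump /=; lia.
Qed.

Lemma smoothE M x :
  smooth M x = (\sum_(i < M.+1) 'C(M, i)%:R * peak (x + M%:Z - (2 * i)%:Z)) / 2 ^+ M.
Proof.
rewrite -/(walk_sum M x); elim: M x => [|M IH] x.
  by rewrite /walk_sum big_ord1 bin0 mul1r expr0 divr1 muln0 addr0 subr0.
by rewrite /= !IH -mulrDl walk_sumS exprSr invfM mulrA.
Qed.

(** The function [T] increases within [0, 8] by at least [peak z] between [z - 1] and [z], so the
    sum telescopes. *)
Lemma sum_peak_le n (y : int) : \sum_(i < n) peak (y - (2 * i)%:Z) <= 8.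
Proof.
pose T (z : int) : R := if 0 <= z then 8 - 4 * peak z else 4 * peak z.
have T_le z : 0 <= T z <= 8.
  by rewrite /T; have := peak01 z; case: ifP => _; lra.
have peakS (k : nat) : peak k.+1 = 3 / 4 * peak k by rewrite /peak /= exprS.
have peakN z : peak (- z) = peak z by rewrite /peak abszN.
have T_step z : peak z <= T z - T (z - 1).
  case: z => [[|k]|k]; rewrite /T.
  - rewrite /= (_ : 0 - 1 = - (1%N : int)) // peakN -[1%N]/(0.+1) peakS /peak expr0; lra.
  - rewrite (_ : k.+1%:Z - 1 = k) /=; last lia.
    by rewrite peakS; have := peak01 k; lra.
  - rewrite (_ : Negz k - 1 = - (k.+2 : int)) /=; last lia.
    by rewrite NegzE !peakN !peakS; have := peak01 k; lra.
have T_mono z : 0 <= T z - T (z - 1).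
  by have := T_step z; have := peak01 z; lra.
have step z : peak z <= T z - T (z - 2).
  have := T_step z; have := T_mono (z - 1); rewrite -addrA -opprD; lra.
have : \sum_(i < n) peak (y - (2 * i)%:Z) <= T y - T (y - (2 * n)%:Z).
  elim: n => [|n IH]; first by rewrite big_ord0 muln0 subr0 subrr.
  rewrite big_ord_recr /=; have := step (y - (2 * n)%:Z).
  by rewrite (_ : y - (2 * n)%:Z - 2 = y - (2 * n.+1)%:Z); [lra|lia].
by have := T_le y; have := T_le (y - (2 * n)%:Z); lra.
Qed.

(** The hypothesis says [b >= (2M+1)^(-1/4)] without roots; the two binomial estimates give this
    bound. *)
Lemma bin_frac_le M i (b : R) : 0 <= b -> 1 <= M.*2.+1%:R * b ^+ 4 ->
  'C(M, i)%:R / 2 ^+ M <= b.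
Proof.
move=> b0 b1; set c := (X in X <= _).
have c0 : 0 <= c by rewrite divr_ge0 ?ler0n ?exprn_ge0.
rewrite -(@ler_pXn2r _ 4) // ?nnegrE //.
have : M.*2.+1%:R * c ^+ 4 <= 1.
  rewrite /c expr_div_n mulrA ler_pdivrMr ?exprn_gt0 // mul1r -exprM mulnC exprM.
  rewrite -!natrX -natrM ler_nat.
  have := central_bin_le M; have := sqr_bin_le M i.
  rewrite (_ : (2 ^ 4 = 16)%N) // => h1; apply: leq_trans.
  by rewrite mulnC leq_mul2r (expnM _ 2 2) leq_exp2r // h1 orbT.
move=> h; have M0 : 0 < M.*2.+1%:R :> R by rewrite ltr0n.
by rewrite -(ler_pM2l M0); apply: le_trans h b1.
Qed.

(** For [M >= a] every binomial weight is at most [b] and the peaks sum to at most 8; for [M < a]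
    the second term already exceeds 1. *)
Lemma smooth_le M x a (b : R) : 0 <= b -> 1 <= a%:R * b ^+ 4 ->
  smooth M x <= 8 * b + 2 ^+ a / 2 ^+ M.
Proof.
move=> b0 ab; have [aM|Ma] := leqP a M.
  have bM i : 'C(M, i)%:R / 2 ^+ M <= b.
    apply: (bin_frac_le i b0); apply: (le_trans ab).
    by rewrite ler_wpM2r ?exprn_ge0 // ler_nat; lia.
  rewrite -[smooth M x]addr0 lerD //; last by rewrite divr_ge0 ?exprn_ge0.
  rewrite smoothE mulr_suml (@le_trans _ _ (b * \sum_(i < M.+1) peak (x + M%:Z - (2 * i)%:Z))) //.
    rewrite mulr_sumr ler_sum // => i _; rewrite mulrAC ler_wpM2r //.
    by case/andP: (peak01 (x + M%:Z - (2 * i)%:Z)).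
  by rewrite mulrC ler_wpM2r // sum_peak_le.
have : 1 <= 2 ^+ a / 2 ^+ M :> R.
  by rewrite ler_pdivlMr ?exprn_gt0 // mul1r ler_eXn2l ?ltr1n // ltnW.
by have := smooth01 M x; lra.
Qed.

End Smoothing.

(** * Mean rank bound of a single log-product *)

Section LogProductMean.
Variables (R : realFieldType) (K : idomainType) (N : nat).
Implicit Types (S : {set 'I_N}) (s : seq ('I_N * 'I_N)).

Definition count1 S s : nat := count (fun p => p.1 \in S) s.
Definition count2 S s : nat := count (fun p => p.2 \in S) s.

Definition seq_balance S s : nat := minn (count1 S s) (count2 S s).

(** Serves as the coloring of the walk. Elements of none of the sets get the default color [t.+1],
    which is not the index of any set in use. *)
Definition set_index (S : nat -> {set 'I_N}) t (x : 'I_N) : nat :=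
  find (fun j => x \in S j) (iota 0 t.+1).

Lemma class_set_index (S : nat -> {set 'I_N}) t j :
    (forall i j, (i < j)%N -> (j <= t)%N -> [disjoint S i & S j]) -> (j <= t)%N ->
  class (set_index S t) j = S j.
Proof.
move=> dS jt; apply/setP=> x; rewrite inE /set_index.
apply/eqP/idP=> [fj|xj].
  have := @nth_find _ 0%N (fun j => x \in S j) (iota 0 t.+1).
  by rewrite has_find fj size_iota ltnS jt nth_iota ?ltnS // add0n; apply.
have h : has (fun j => x \in S j) (iota 0 t.+1).
  by apply/hasP; exists j; rewrite ?mem_iota ?ltnS.
have := nth_find 0%N h; move: h; rewrite has_find size_iota.
set i := find _ _ => it; rewrite nth_iota // add0n => xi.
have [ij|ji|//] := ltngtP i j.
  by have /pred0P/(_ x) /= := dS _ _ ij jt; rewrite xi xj.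
by have /pred0P/(_ x) /= := dS _ _ ji it; rewrite xi xj.
Qed.

Lemma sum_count_disjoint (S : nat -> {set 'I_N}) t (s : seq 'I_N) :
    (forall i j, (i < j)%N -> (j <= t)%N -> [disjoint S i & S j]) ->
  (\sum_(j < t.+1) count (mem (S j)) s <= size s)%N.
Proof.
move=> dS; elim: s => [|x s IH] /=; first by rewrite big1.
rewrite big_split /= -[(size s).+1]add1n leq_add //.
have cE (j : 'I_t.+1) : (x \in S j) = (set_index S t x == j).
  by rewrite -(class_set_index dS (_ : j <= t)%N) ?inE // -ltnS.
under eq_bigr => j _ do rewrite cE.
have [xt|xt] := ltnP (set_index S t x) t.+1.
  rewrite (bigD1 (Ordinal xt)) //= eqxx big1 // => j.
  by rewrite -val_eqE eq_sym /= => /negPf ->.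
by rewrite big1 // => j _; case: eqP => // e; rewrite e leqNgt ltn_ord in xt.
Qed.

Lemma drift_sum_count (color : 'I_N -> nat) j s :
  drift_sum color j s = (count1 (class color j.*2) s)%:Z - (count2 (class color j.*2) s)%:Z.
Proof.
elim: s => [|p s IH]; first by rewrite /drift_sum big_nil.
rewrite /drift_sum big_cons -/(drift_sum color j s) IH /count1 /count2 /drift /= !inE.
by case: (color p.1 == _); case: (color p.2 == _); lia.
Qed.

Lemma sum_even_le (f : nat -> nat) n tau : (tau.*2 <= n)%N ->
  (\sum_(j < tau) f j.*2 <= \sum_(j < n) f j)%N.
Proof.
move=> le; rewrite -(subnKC le); move: (n - tau.*2)%N => k.
elim: k => [|k IH]; last by rewrite addnS big_ord_recr /= (leq_trans IH) ?leq_addr.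
rewrite addn0; elim: tau {le} => [|tau IH]; first by rewrite !big_ord0.
by rewrite doubleS !big_ord_recr /= -addnA leq_add ?leq_addr.
Qed.

(** Since [2 min(p, q) + |p - q| = p + q] and disjoint sets have total count at most [2 * size s],
    every unit of imbalance costs half a unit of exponent. Only the imbalances of the even sets are
    kept. *)
Lemma balance_peak (S : nat -> {set 'I_N}) t tau s :
    (forall i j, (i < j)%N -> (j <= t)%N -> [disjoint S i & S j]) ->
    (tau.*2 <= t.+1)%N ->
  2 ^+ (\sum_(j < t.+1) seq_balance (S j) s) <=
    2 ^+ size s * \prod_(j < tau) peak R (drift_sum (set_index S t) j s).
Proof.
move=> dS tt; rewrite prodrXr.
have -> : (\sum_(j < tau) `|drift_sum (set_index S t) j s|)%N =
    (\sum_(j < tau) (maxn (count1 (S j.*2) s) (count2 (S j.*2) s)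
      - seq_balance (S j.*2) s))%N.
  apply: eq_bigr => j _; rewrite drift_sum_count class_set_index //; last first.
    by have := ltn_ord j; lia.
  by rewrite /seq_balance; lia.
set D := (\sum_(j < tau) _)%N; set B := (\sum_(j < t.+1) _)%N.
have BD : (2 * B + D <= 2 * size s)%N.
  have D_le : (D <= \sum_(j < t.+1) (maxn (count1 (S j) s) (count2 (S j) s)
      - seq_balance (S j) s))%N.
    exact: (sum_even_le (fun j => maxn (count1 (S j) s) (count2 (S j) s)
      - seq_balance (S j) s)%N tt).
  apply: (@leq_trans (\sum_(j < t.+1) count1 (S j) s + \sum_(j < t.+1) count2 (S j) s)).
    apply: leq_trans (leq_add (leqnn _) D_le) _.
    rewrite /B big_distrr -!big_split leq_sum //= => j _.
    by rewrite /seq_balance; lia.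
  have h1 := sum_count_disjoint (unzip1 s) dS.
  have h2 := sum_count_disjoint (unzip2 s) dS.
  rewrite size_map (eq_bigr (fun j : 'I_t.+1 => count1 (S j) s)) in h1; last first.
    by move=> j _; rewrite count_map.
  rewrite size_map (eq_bigr (fun j : 'I_t.+1 => count2 (S j) s)) in h2; last first.
    by move=> j _; rewrite count_map.
  by have := leq_add h1 h2; rewrite mul2n -addnn; apply: leq_trans.
have [k kE] : exists k, (size s = B + k)%N by exists (size s - B)%N; lia.
have Dk : (D <= 2 * k)%N by lia.
rewrite kE exprD -mulrA ler_peMr ?exprn_ge0 //.
(* The middle term is [(9/8)^k], hence at least 1. *)
apply: (@le_trans _ _ (2 ^+ k * (3 / 4) ^+ (2 * k))).
  by rewrite exprM -exprMn exprn_ege1 //; lra.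
by rewrite ler_wpM2l ?exprn_ge0 // ler_wiXn2l //; lra.
Qed.

Lemma log_product_mean t tau m a (b : R) (T : term K N) :
    (0 < N)%N -> (tau.*2 <= t.+1)%N -> 0 < b -> 1 <= a%:R * b ^+ 4 ->
    log_product t [set: 'I_N] T ->
  Ex m (fun s => 2 ^+ (\sum_(j < t.+1) seq_balance (T.1 j) s)) <=
    2 ^+ m * (8 * b + 2 ^+ a * (1 - (9 ^+ t)^-1) ^+ m) ^+ tau.
Proof.
move=> N0 tt b0 ab [_ big_T _ dT]; set col := set_index T.1 t.
have peak_ge0 M x : 0 <= smooth R M x by case/andP: (smooth01 R M x).
apply: (@le_trans _ _ (Ex m (fun s => 2 ^+ m * \prod_(j < tau) peak R (drift_sum col j s)))).
  by apply: Ex_le => s <-; exact: balance_peak.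
rewrite ExZ ler_wpM2l ?exprn_ge0 //.
have := @walk_bound R 'I_N col tau (smooth R) (8 * b) (2 ^+ a) peak_ge0.
move=> /(_ _ _ _ _ m) wb; apply: le_trans (wb _ _ _ _ _) _.
- by move=> M x /=; lra.
- by move=> M x; apply: smooth_le => //; exact: ltW.
- lra.
- exact: exprn_ge0.
- by rewrite card_ord.
set q := 8 * b + _; rewrite (_ : q ^+ tau = \prod_(j < tau) q); last first.
  by rewrite prodr_const card_ord.
apply: ler_prod => j _; rewrite {}/q.
have jt : (j.*2.+1 <= t)%N by have := ltn_ord j; lia.
(* Both sets of the pair hold a fraction at least [3^-t] of the variables. *)
have m1 : (9 ^+ t)^-1 <= meet R col j.
  have N2 : 0 < (N ^ 2)%:R :> R by rewrite ltr0n expn_gt0 N0.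
  rewrite /meet !class_set_index ?(ltnW jt) // card_ord ler_pdivlMr //.
  rewrite ler_pdivrMl ?exprn_gt0 // -natrX -natrM ler_nat.
  have := leq_mul (big_T _ (ltnW jt)) (big_T _ jt).
  by rewrite cardsT card_ord mulnACA -expnMn.
have m2 := meet_le1 R col j.
rewrite addr_ge0 ?mulr_ge0 ?exprn_ge0 ?(ltW b0) ?subr_ge0 //=.
by rewrite lerD2l ler_wpM2l ?exprn_ge0 // lerXn2r ?nnegrE ?subr_ge0 ?lerD2l ?lerN2 // (le_trans m1).
Qed.

End LogProductMean.

(** * Rows of the binary Vandermonde matrix *)

Lemma card_left_kernel (F : finFieldType) m n (A : 'M[F]_(m, n)) :
  #|[set w : 'rV_m | w *m A == 0]| = (#|F| ^ (m - \rank A))%N.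
Proof.
rewrite -mxrank_ker -card_rowg; apply: eq_card => w.
by rewrite inE mem_rowg; apply/eqP/sub_kermxP.
Qed.

Lemma card_right_kernel (F : finFieldType) m n (A : 'M[F]_(m, n)) :
  #|[set w : 'cV_n | A *m w == 0]| = (#|F| ^ (n - \rank A))%N.
Proof.
rewrite -mxrank_tr -card_left_kernel -(card_imset _ (@trmx_inj F n 1)).
apply: eq_card => w; rewrite [RHS]inE.
apply/imsetP/eqP=> [[v + ->]|wA].
  by rewrite inE -trmx_mul => /eqP->; rewrite trmx0.
exists w^T; rewrite ?trmxK // inE -(inj_eq (@trmx_inj _ _ _)) trmx_mul trmxK wA.
by rewrite trmx0.
Qed.

Lemma big_tagnat (V : Type) (idx : V) (op : Monoid.com_law idx) q (p_ : 'I_q -> nat)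
    (F : 'I_(\sum_j p_ j) -> V) :
  \big[op/idx]_u F u = \big[op/idx]_j \big[op/idx]_(c < p_ j) F (tagnat.Rank j c).
Proof.
rewrite sig_big_dep (reindex (@tagnat.rank q p_)) /=; last first.
  exact/onW_bij/tagnat.rank_bij.
by apply: eq_bigr => -[j c] _; rewrite tagnat.rankE.
Qed.

Section RowCount.
Variables (h : {poly 'F_2}) (hI : monic_irreducible_poly h) (d n k : nat).
Variable label : 'I_n -> {poly %/ h with hI}.
Hypotheses (size_h : size h = d.+1) (label_inj : injective label).
Local Notation L := {poly %/ h with hI}.
Local Notation dims := (\sum_(j < k) d)%N.

Let mk_h : mk_monic h = h.
Proof. exact: mk_monicE. Qed.

Lemma encode_inj : injective (@encode h hI d).
Proof.
move=> p q /colP pq; apply/val_inj/polyP=> i.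
have [id|di] := ltnP i d.
  by have := pq (Ordinal id); rewrite !mxE.
have small (r : L) : (size (r : {poly 'F_2}) <= i)%N.
  by apply: leq_trans (size_npoly r) _; rewrite mk_h size_h.
by rewrite (nth_default _ (small p)) (nth_default _ (small q)).
Qed.

Lemma encodeD : {morph @encode h hI d : p q / p + q}.
Proof. by move=> p q; apply/colP=> i; rewrite !mxE /= coefD. Qed.

Lemma encode0 : encode d (0 : L) = 0.
Proof. by apply/colP=> i; rewrite !mxE /= coef0. Qed.

Definition decode (w : 'cV['F_2]_d) : L :=
  in_qpoly h (\poly_(c < d) (if insub c is Some c' then w c' 0 else 0)).

Lemma decodeK w : encode d (decode w) = w.
Proof.
apply/colP=> i; rewrite mxE /decode in_qpoly_small; last first.
  by rewrite mk_h size_h ltnS size_poly.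
by rewrite coef_poly ltn_ord valK.
Qed.

Definition block_row i : 'M['F_2]_(d, dims) :=
  \mxrow_(j < k) mulq_mx d (label i ^+ j).

(** The decoded blocks of [psi] serve as coefficients, so that multiplication by [block_row i]
    becomes evaluation at [label i]. *)
Definition block_poly (psi : 'cV['F_2]_dims) : {poly L} :=
  \poly_(j < k) (if insub j is Some j' then
    decode (\col_c psi (tagnat.Rank (p_ := fun=> d) j' c) 0) else 0).

Lemma block_rowE i psi :
  block_row i *m psi = encode d (block_poly psi).[label i].
Proof.
rewrite horner_poly (big_morph _ encodeD encode0); apply/colP=> r.
rewrite summxE mxE (big_tagnat _ (fun c => block_row i r c * psi c 0)).
apply: eq_bigr => j _; rewrite valK mulrC -mulq_mxE // decodeK !mxE.
by apply: eq_bigr => c _; rewrite !mxE tagnat.Rank1K tagnat.Rank2K.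
Qed.
Lemma block_poly_neq0 (psi : 'cV_dims) : psi != 0 -> block_poly psi != 0.
Proof.
apply: contra_neq => Q0; apply/colP=> c; rewrite mxE -(tagnat.sig2K c).
set j := tagnat.sig1 c; have := congr1 (fun Q : {poly L} => Q`_j) Q0.
rewrite /= coef0 coef_poly ltn_ord valK => /(congr1 (encode d)).
by rewrite decodeK encode0 => /colP /(_ (tagnat.sig2 c)); rewrite !mxE.
Qed.

Lemma card_block_roots (psi : 'cV_dims) :
  psi != 0 -> (#|[set i | block_row i *m psi == 0%R]| <= k)%N.
Proof.
move=> /block_poly_neq0 Q0; set A := [set _ | _].
have := max_poly_roots Q0 (rs := [seq label i | i <- enum A]).
rewrite size_map -cardE map_inj_uniq ?enum_uniq // => lt.
apply: ltnW; apply: leq_trans (lt _ isT) (size_poly _ _).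
apply/allP=> _ /mapP[i + ->]; rewrite mem_enum inE block_rowE -encode0.
by move=> /eqP /encode_inj /eqP.
Qed.

Lemma row_mxblock_hadamard u :
  row u (\mxblock_(i < n, j < k) (hadamard_mx d *m mulq_mx d (label i ^+ j))) =
  row (tagnat.sig2 (p_ := fun=> (2 ^ d)%N) u) (hadamard_mx d) *m block_row (tagnat.sig1 u).
Proof.
apply/rowP=> c; rewrite !mxE; apply: eq_bigr => l _.
by rewrite !mxE.
Qed.

(** The rows of the Hadamard matrix list every vector exactly once. *)
Lemma card_hadamard_rows (P : pred 'rV['F_2]_d) :
  #|[set r | P (row r (hadamard_mx d))]| = #|[set w | P w]|.
Proof.
have rowE r : row r (hadamard_mx d) = enum_val (cast_ord (esym (card_F2_vectors d)) r).
  by apply/rowP=> c; rewrite !mxE.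
rewrite -(card_imset [set r | _] (f := fun r => row r (hadamard_mx d))); last first.
  by move=> r s; rewrite !rowE => /enum_val_inj /cast_ord_inj.
apply: eq_card => w; rewrite [RHS]inE; apply/imsetP/idP=> [[r + ->]|Pw].
  by rewrite inE.
pose r := cast_ord (card_F2_vectors d) (enum_rank w).
have rw : row r (hadamard_mx d) = w by rewrite rowE /r cast_ordK enum_rankK.
by exists r; rewrite ?inE rw.
Qed.

(* Double counting: for each label the left and right kernels of block_row * coker S
   have proportional sizes, and a nonzero vector is killed by fewer than k labels
   because it encodes a nonzero polynomial of degree less than k. *)
Lemma card_mxblock_rows p (S : 'M['F_2]_(p, dims)) :
  (#|[set u | (row u (\mxblock_(i < n, j < k)
       (hadamard_mx d *m mulq_mx d (label i ^+ j))) <= S)%MS]| * 2 ^ dims <=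
   2 ^ d * (2 ^ \rank S * n + 2 ^ dims * k))%N.
Proof.
pose A i := block_row i *m cokermx S.
have F2 : #|{: 'F_2}| = 2 by rewrite card_Fp.
(* The rows of block [i] are [w *m block_row i] for all [w], and lying in [S] means being killed by
   its cokernel. *)
have -> : #|[set u | (row u (\mxblock_(i < n, j < k)
       (hadamard_mx d *m mulq_mx d (label i ^+ j))) <= S)%MS]| =
    (\sum_(i < n) #|[set w : 'rV_d | w *m A i == 0%R]|)%N.
  rewrite -sum1_card big_mkcond /=.
  rewrite big_tagnat; apply: eq_bigr => i _.
  rewrite -card_hadamard_rows -sum1_card [RHS]big_mkcond; apply: eq_bigr => r _.
  rewrite !inE row_mxblock_hadamard submxE -mulmxA tagnat.Rank1K -/(A i).
  congr (if _ *m _ == _ then _ else _).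
  by rewrite tagnat.Rank2K; congr (row _ _); exact: val_inj.
have dual i : (#|[set w : 'rV_d | w *m A i == 0%R]| * 2 ^ dims =
    2 ^ d * #|[set phi : 'cV_dims | A i *m phi == 0%R]|)%N.
  rewrite card_left_kernel card_right_kernel F2 -!expnD; congr (2 ^ _)%N.
  by rewrite addnBAC ?rank_leq_row // addnBA ?rank_leq_col.
rewrite big_distrl (eq_bigr _ (fun i _ => dual i)) -big_distrr leq_mul2l /=.
apply/orP; right.
have -> : (\sum_(i < n) #|[set phi : 'cV_dims | A i *m phi == 0%R]| =
    \sum_(phi : 'cV['F_2]_dims) #|[set i | block_row i *m (cokermx S *m phi) == 0%R]|)%N.
  under eq_bigr => i _ do rewrite -sum1_card big_mkcond.
  rewrite exchange_big /=; apply: eq_bigr => phi _.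
  rewrite -sum1_card [RHS]big_mkcond; apply: eq_bigr => i _.
  by rewrite !inE mulmxA.
(* A [phi] killed by the cokernel may count for all [n] labels, any other for at most [k]. *)
apply: (@leq_trans (\sum_(phi : 'cV['F_2]_dims) ((cokermx S *m phi == 0%R) * n + k))).
  apply: leq_sum => phi _; have [_|/card_block_roots le] := eqVneq (cokermx S *m phi) 0.
    by rewrite mul1n (leq_trans (max_card _)) ?card_ord ?leq_addr.
  exact: leq_trans le (leq_addl _ _).
have cardV : #|{: 'cV['F_2]_dims}| = (2 ^ dims)%N by rewrite card_mx F2 muln1.
rewrite big_split /= [X in (_ + X <= _)%N]sum_nat_const cardV leq_add // -big_distrl leq_mul2r /=.
apply/orP; right.
have -> : (\sum_(phi : 'cV['F_2]_dims) (cokermx S *m phi == 0%R) =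
    #|[set phi : 'cV_dims | cokermx S *m phi == 0%R]|)%N.
  rewrite -sum1_card [RHS]big_mkcond; apply: eq_bigr => phi _.
  by rewrite inE; case: eqP.
rewrite card_right_kernel F2 mxrank_coker leq_exp2l //.
by rewrite subKn ?rank_leq_col.
Qed.

Lemma card_Vbin_rows p (S : 'M['F_2]_(p, k * d)) :
  (#|[set u | (row u (Vbin d k label) <= S)%MS]| * 2 ^ (k * d) <=
   2 ^ d * (2 ^ \rank S * n + 2 ^ (k * d) * k))%N.
Proof.
rewrite /Vbin; move: S.
case: _ / (sum_nat_const_ord k d); case: _ / (sum_nat_const_ord n (2 ^ d)) => S.
by rewrite castmx_id; exact: card_mxblock_rows.
Qed.

End RowCount.

(** * Random rows, their independence and the restricted kernel indicator *)

Section IndependentRows.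
Variables (N D : nat) (V : 'M['F_2]_(N, D)).

Definition row_span (s : seq 'I_N) : 'M['F_2]_D := (\sum_(u <- s) <<row u V>>)%MS.

Definition indep (s : seq 'I_N) : bool := \rank (row_span s) == size s.

Lemma row_span_cons u s : (row_span (u :: s) :=: row u V + row_span s)%MS.
Proof. by rewrite /row_span big_cons; apply/adds_eqmx => //; exact: genmxE. Qed.

Lemma indep_cons u s :
  indep s -> ~~ (row u V <= row_span s)%MS -> indep (u :: s).
Proof.
move=> /eqP si nu; rewrite /indep row_span_cons /= eqn_leq; apply/andP; split.
  apply: leq_trans (mxrank_adds_leqif _ _).1 _.
  by rewrite si -[(size s).+1]add1n leq_add ?rank_leq_row.
rewrite -si ltnNge; apply: contra nu => le.
apply: submx_trans (addsmxSl _ (row_span s)) _.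
by rewrite -(geq_leqif (mxrank_leqif_sup (addsmxSr (row u V) (row_span s)))).
Qed.

Section Probability.
Variables (R : realFieldType) (kappa : R).
Hypothesis rowV_le : forall S : 'M['F_2]_D,
  #|[set u | (row u V <= S)%MS]|%:R / N%:R <= 2 ^+ \rank S / 2 ^+ D + kappa.
Hypotheses (N_gt0 : (0 < N)%N) (kappa_ge0 : 0 <= kappa).

Let P L : R := Ex L (fun s : seq 'I_N => (indep s)%:R).

Let P_le1 L : P L <= 1.
Proof.
rewrite -(@Ex_cst R 'I_N L 1) ?card_ord //.
by apply: Ex_le => s _; case: (indep s).
Qed.

(** An independent tail spans dimension [L], so a fresh row falls into its span with probability at
    most [2^L / 2^D + kappa]. *)
Lemma indep_prob_step L :
  P L * (1 - (2 ^+ L / 2 ^+ D + kappa)) <= P L.+1.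
Proof.
have NR : 0 < N%:R :> R by rewrite ltr0n.
rewrite mulrC /P ExS -ExZ; apply: Ex_le => s sL.
have [si|_] := boolP (indep s); last first.
  by rewrite mulr0 divr_ge0 ?sumr_ge0.
rewrite mulr1 card_ord ler_pdivlMr //.
apply: (@le_trans _ _ (\sum_(u < N) (1 - (row u V <= row_span s)%MS%:R))).
  rewrite sumrB sumr_const card_ord mulrBl mul1r lerD2l lerN2.
  have := rowV_le (row_span s); rewrite (eqP si) sL ler_pdivrMr //.
  congr (_ <= _); rewrite -sum1_card natr_sum big_mkcond; apply: eq_bigr => u _.
  by rewrite inE; case: (_ <= _)%MS.
apply: ler_sum => u _; case: (boolP (row u V <= row_span s)%MS) => [_|nu].
  by rewrite subrr ler0n.
by rewrite subr0 (indep_cons si nu).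
Qed.

(** The failure probabilities of the single steps add up, and the geometric part stays below
    [2^L / 2^D]. *)
Lemma indep_prob_ge L : (L <= D)%N -> 1 - 2 ^+ L / 2 ^+ D - L%:R * kappa <= P L.
Proof.
elim: L => [|L IH] LD.
  rewrite mul0r subr0 /P /= /indep /row_span big_nil mxrank0 eqxx expr0 mul1r.
  by rewrite gerBl invr_ge0 exprn_ge0.
apply: le_trans (indep_prob_step L); have := IH (ltnW LD).
have : 0 <= 2 ^+ L / 2 ^+ D :> R by rewrite divr_ge0 ?exprn_ge0.
rewrite exprS -mulrA -[L.+1]addn1 natrD mulrDl mul1r.
by move: (_ / _) (P L) (P_le1 L) => e p p1 e0; have := kappa_ge0; nra.
Qed.

(** At [L = D] the additive bound is vacuous; it is used up to [D - 1], giving at least 3/8, and the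
    last step is multiplied in with a factor at least 3/8. *)
Lemma indep_prob : (0 < D)%N -> D%:R * kappa <= 1 / 8 -> 1 / 8 <= P D.
Proof.
move=> D0 Dk; have ge := indep_prob_ge (leq_pred D); have step := indep_prob_step D.-1.
have e2 : 2 ^+ D.-1 / 2 ^+ D = 1 / 2 :> R.
  rewrite -[in X in _ / X](prednK D0) exprS invfM mulrCA.
  by rewrite mulfV ?mulr1 ?div1r // expf_neq0 // pnatr_eq0.
rewrite e2 prednK // in ge step.
have : D.-1%:R * kappa + kappa <= 1 / 8.
  by move: Dk; rewrite -[in D%:R](prednK D0) -natr1 mulrDl mul1r.
have : 0 <= D.-1%:R * kappa by rewrite mulr_ge0.
by move: (P D.-1) (P D) ge step => p q ge step *; have := kappa_ge0; nra.
Qed.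

Definition common (s : seq ('I_N * 'I_N)) : bool := has (mem (unzip1 s)) (unzip2 s).

Definition good (s : seq ('I_N * 'I_N)) : bool :=
  [&& indep (unzip1 s), indep (unzip2 s) & ~~ common s].

Lemma Ex_count_mem L x : Ex L (fun s : seq 'I_N => (count_mem x s)%:R) = L%:R / N%:R :> R.
Proof.
have NR : N%:R != 0 :> R by rewrite pnatr_eq0 -lt0n.
elim: L => [|L IH]; first by rewrite mul0r.
rewrite ExS (@Ex_eq _ _ _ _ (fun s => (N%:R)^-1 + (count_mem x s)%:R)) => [|s _].
  rewrite ExD IH Ex_cst ?card_ord //.
  by rewrite -addn1 natrD mulrDl div1r addrC.
rewrite card_ord /= (eq_bigr (fun u => (u == x)%:R + (count_mem x s)%:R)).
  rewrite big_split /= sumr_const card_ord mulrDl -[(count_mem x s)%:R *+ N]mulr_natr mulfK //.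
  rewrite (bigD1 x) //= eqxx big1 ?addr0 ?div1r // => u /negPf->.
  by [].
by move=> u _; rewrite natrD.
Qed.

Lemma common_prob L :
  Ex L (fun s => (common s)%:R) <= (L ^ 2)%:R / N%:R :> R.
Proof.
have NR : N%:R != 0 :> R by rewrite pnatr_eq0 -lt0n.
apply: (@le_trans _ _ (Ex L (fun s : seq ('I_N * 'I_N) =>
    \sum_(x < N) (count_mem x (unzip1 s))%:R * (count_mem x (unzip2 s))%:R))).
  apply: Ex_le => s _; rewrite /common; case: hasP => [[x x2 x1]|_]; last first.
    by rewrite sumr_ge0 // => x _; rewrite mulr_ge0.
  rewrite (bigD1 x) //= -natrM -[1]/(1%:R) -[X in X <= _]addr0 lerD //.
    by rewrite ler_nat muln_gt0 -!has_count !has_pred1 x2 (x1 : x \in unzip1 s).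
  by rewrite sumr_ge0 // => i _; rewrite mulr_ge0.
rewrite Ex_sum (eq_bigr (fun=> (L%:R / N%:R) ^+ 2)) => [|x _]; last first.
  rewrite (Ex_pair L (fun s => (count_mem x s)%:R) (fun s => (count_mem x s)%:R)).
  by rewrite Ex_count_mem expr2.
rewrite sumr_const card_ord -mulr_natr natrX le_eqVlt; apply/orP; left; apply/eqP.
by field.
Qed.

(** The two halves are independent, so both are bases with probability at least 1/64, of which
    collisions take at most 1/128. *)
Lemma good_prob :
    (0 < D)%N -> D%:R * kappa <= 1 / 8 -> (D ^ 2)%:R / N%:R <= 1 / 128 :> R ->
  1 / 128 <= Ex D (fun s => (good s)%:R) :> R.
Proof.
move=> D0 Dk coll; have pD := indep_prob D0 Dk.
have : P D * P D <= Ex D (fun s => (good s)%:R) + Ex D (fun s => (common s)%:R).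
  rewrite -Ex_pair -ExD; apply: Ex_le => s _; rewrite /good.
  case: (indep _); case: (indep _); case: (common s); rewrite /= ?mulr0 ?mulr1 ?mul0r; lra.
by have := common_prob D; move: pD; nra.
Qed.

End Probability.

Definition subset_sum (w : 'I_D -> 'I_N) (y : {set 'I_D}) : 'rV['F_2]_D :=
  \sum_(l in y) row (w l) V.

Lemma subset_sum_inj (w : D.-tuple 'I_N) : indep w -> injective (subset_sum (tnth w)).
Proof.
move=> wi; pose U := \matrix_(l < D) row (tnth w l) V.
have U_free : row_free U.
  rewrite /row_free eqn_leq rank_leq_row /= -[X in (X <= _)%N](size_tuple w) -(eqP wi).
  rewrite /row_span big_tuple; apply/mxrankS/sumsmx_subP => l _.
  by rewrite genmxE -(rowK (fun l => row (tnth w l) V)) row_sub.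
have sumE y : subset_sum (tnth w) y = (\row_l (l \in y)%:R) *m U.
  rewrite mulmx_sum_row /subset_sum big_mkcond; apply: eq_bigr => l _.
  by rewrite rowK mxE; case: (l \in y); rewrite ?scale1r ?scale0r.
move=> y z; rewrite !sumE => /(row_free_inj U_free) /rowP yz; apply/setP=> l.
by have := yz l; rewrite !mxE; case: (l \in y); case: (l \in z).
Qed.

Lemma indep_tnth_inj (w : D.-tuple 'I_N) : indep w -> injective (tnth w).
Proof.
move=> /subset_sum_inj wi l l' ll'; apply/set1_inj/wi.
by rewrite /subset_sum !big_set1 ll'.
Qed.

(** The product adds up the rows whose variables are set to 1; disjoint images keep the
    contributions of [y] and [z] apart. *)
Lemma kernel_assignment (u v : 'I_D -> 'I_N) y z :
    injective u -> injective v -> (forall l l', u l != v l') ->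
  (V^T *m cube_col (assignment u v y z) == 0) =
  (subset_sum u y == - subset_sum v z).
Proof.
move=> iu iv uv; rewrite -addr_eq0 -(inj_eq (@trmx_inj _ _ _)) trmx_mul trmxK trmx0.
congr (_ == 0); rewrite mulmx_sum_row.
rewrite /subset_sum -(big_imset (fun i => row i V) (in2W iu)).
rewrite -(big_imset (fun i => row i V) (in2W iv)) /=.
rewrite [X in _ = X + _]big_mkcond [X in _ = _ + X]big_mkcond -big_split; apply: eq_bigr => i _ /=.
rewrite !mxE ffunE; case: imsetP => [[l ly il]|_]; case: imsetP => [[l' lz il']|_].
- by have := uv l l'; rewrite -il -il' eqxx.
- by rewrite scale1r addr0.
- by rewrite scale1r add0r.
- by rewrite scale0r addr0.
Qed.

Lemma balance_tuple (s : D.-tuple ('I_N * 'I_N)) S :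
  balance (fun l => (tnth s l).1) (fun l => (tnth s l).2) S = seq_balance S s.
Proof.
have cE (p : pred ('I_N * 'I_N)) (A : {set 'I_D}) :
    A =i [pred l | p (tnth s l)] -> #|A| = count p s.
  by move=> Ap; rewrite (eq_card Ap) -sum1_card -sum1_count big_tuple.
congr minn.
  by apply: (cE (fun p => p.1 \in S)) => l; rewrite !inE.
by apply: (cE (fun p => p.2 \in S)) => l; rewrite !inE.
Qed.

(** For good [s] both subset-sum maps are bijections by counting, so the restricted indicator is a
    permutation matrix of order [2^D]; the right side bounds its rank. *)
Lemma kernel_decomposition (K : fieldType) t (ts : seq (term K N))
    (s : seq ('I_N * 'I_N)) :
    List.Forall (log_product t [set: 'I_N]) ts ->
    (forall x, kernel_indicator K V x = \sum_(T <- ts) term_eval t T x) ->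
    size s = D -> good s ->
  (2 ^ D <= \sum_(T <- ts) 2 ^ (\sum_(j < t.+1) seq_balance (T.1 j) s))%N.
Proof.
move=> Fts Ets /eqP sD; rewrite -[s]/(val (Tuple sD)).
move: (Tuple sD) => {sD}s /and3P[i1 i2 /hasPn dis].
pose u l := (tnth s l).1; pose v l := (tnth s l).2.
have tu : u =1 tnth (map_tuple fst s) by move=> l; rewrite tnth_map.
have tv : v =1 tnth (map_tuple snd s) by move=> l; rewrite tnth_map.
have ssE (w w' : 'I_D -> 'I_N) : w =1 w' -> subset_sum w =1 subset_sum w'.
  by move=> e y; apply: eq_bigr => l _; rewrite e.
have ju : injective (subset_sum u).
  by move=> y z; rewrite !(ssE _ _ tu); exact: (@subset_sum_inj (map_tuple fst s)).
have jv : injective (fun z => - subset_sum v z).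
  by move=> y z /oppr_inj; rewrite !(ssE _ _ tv); exact: (@subset_sum_inj (map_tuple snd s)).
have iu : injective u.
  by move=> l l'; rewrite !tu; exact: (@indep_tnth_inj (map_tuple fst s)).
have iv : injective v.
  by move=> l l'; rewrite !tv; exact: (@indep_tnth_inj (map_tuple snd s)).
have uv l l' : u l != v l'.
  apply/eqP=> e; have := dis (v l').
  rewrite /v; move/(_ (map_f _ (mem_tnth _ _)))/negP; apply; rewrite -/(v l') -e.
  exact: (map_f _ (mem_tnth _ _)).
have cardV : #|{: 'rV['F_2]_D}| = (2 ^ D)%N by rewrite card_mx mul1n card_Fp.
have cardS : #|{: {set 'I_D}}| = (2 ^ D)%N.
  by rewrite -cardsT -powersetT card_powerset cardsT card_ord.
have card_le : (#|{: 'rV['F_2]_D}| <= #|{: {set 'I_D}}|)%N by rewrite cardV cardS.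
rewrite -cardV.
under eq_bigr => T _ do under eq_bigr => j _ do rewrite -balance_tuple.
apply: (sep_rank_le_bij (K := K) (inj_card_bij ju card_le) (inj_card_bij jv card_le)).
apply: sep_rank_le_ext (decomposition_rank u v Fts) => y z.
by rewrite -Ets /kernel_indicator kernel_assignment.
Qed.

End IndependentRows.

(** * The size bound with explicit parameters *)

Lemma sum_Forall_le (R : numDomainType) (I : Type) (P : I -> Prop) (r : seq I)
    (F : I -> R) (c : R) :
    List.Forall P r -> (forall i, P i -> F i <= c) ->
  \sum_(i <- r) F i <= (size r)%:R * c.
Proof.
move=> Pr Fc; elim: Pr => [|i {}r Pi _ IH]; first by rewrite big_nil mul0r.
by rewrite big_cons /= -natr1 mulrDl mul1r addrC lerD ?Fc.
Qed.

(** Averages the rank inequality over random [s]: good sequences make the left mean at least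
    [2^D / 128], while each term on the right has mean at most [2^D * rho^tau]. *)
Lemma combinatorial_bound (R : realFieldType) (K : fieldType)
    (h : {poly 'F_2}) (hI : monic_irreducible_poly h) (d n k : nat)
    (label : 'I_n -> {poly %/ h with hI}) (F : formula K (n * 2 ^ d))
    (t tau a : nat) (b : R) :
    size h = d.+1 -> injective label -> (0 < n)%N -> (0 < k * d)%N ->
    (k * (k * d))%:R / n%:R <= 1 / 128 :> R ->
    (2 * 3 ^ t <= n * 2 ^ d)%N -> (tau.*2 <= t.+1)%N ->
    0 < b -> 1 <= a%:R * b ^+ 4 ->
    multilinear_formula F -> represents F (kernel_indicator K (Vbin d k label)) ->
  1 <= 128 * (formula_size F)%:R *
    (8 * b + 2 ^+ a * (1 - (9 ^+ t)^-1) ^+ (k * d)) ^+ tau.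
Proof.
move=> sh label_inj n0 D0 kD tN tt b0 ab MF repF.
set V := Vbin d k label; set D := (k * d)%N; set N := (n * 2 ^ d)%N.
set rho := 8 * b + _.
have N0 : (0 < N)%N by rewrite muln_gt0 n0 expn_gt0.
have nR : 0 < n%:R :> R by rewrite ltr0n.
have NR : 0 < N%:R :> R by rewrite ltr0n.
have pD : 0 < 2 ^+ D :> R by rewrite exprn_gt0.
have [ts [ts_size Fts Ets]] : decomposable t [set: 'I_N] (formula_size F)
    (feval F [set: 'I_N]).
  by apply: formula_decomposition; rewrite // cardsT card_ord.
have fE x : kernel_indicator K V x = \sum_(T <- ts) term_eval t T x.
  rewrite -repF -Ets; apply: mpoly.meval_eq => i.
  by rewrite ffunE in_setT.
have rowV (S : 'M['F_2]_D) : #|[set u | (row u V <= S)%MS]|%:R / N%:R <=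
    2 ^+ \rank S / 2 ^+ D + k%:R / n%:R :> R.
  have := card_Vbin_rows sh label_inj S; rewrite -(ler_nat R) -/V -/D.
  rewrite [in X in X <= _]natrM natrM natrD !natrM !natrX => le.
  have NR' : 0 < n%:R * 2 ^+ d :> R by rewrite -natrX -natrM.
  rewrite ler_pdivrMr // -[X in X <= _](mulfK (lt0r_neq0 pD)) ler_pdivrMr //.
  apply: le_trans le _.
  rewrite le_eqVlt; apply/orP; left; apply/eqP.
  by field; rewrite !gt_eqF.
have kappa0 : 0 <= k%:R / n%:R :> R by rewrite divr_ge0.
have Dk : D%:R * (k%:R / n%:R) <= 1 / 128 :> R.
  by move: kD; rewrite -/D natrM mulrAC [_ * D%:R]mulrC.
(* Since [d <= 2^d], the ratio [D^2 / N] is at most [k * D / n]. *)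
have coll : (D ^ 2)%:R / N%:R <= 1 / 128 :> R.
  apply: le_trans kD; rewrite ler_pdivrMr // mulrAC ler_pdivlMr // -!natrM ler_nat.
  have : (d <= 2 ^ d)%N by rewrite ltnW // ltn_expl.
  by rewrite /D /N; nia.
have gp : 1 / 128 <= Ex D (fun s => (good V s)%:R) :> R.
  by apply: good_prob rowV N0 kappa0 D0 _ coll; apply: le_trans Dk _; lra.
have : 2 ^+ D * Ex D (fun s => (good V s)%:R) <= (formula_size F)%:R * (2 ^+ D * rho ^+ tau).
  rewrite -ExZ; apply: (@le_trans _ _ (Ex D (fun s =>
      \sum_(T <- ts) 2 ^+ (\sum_(j < t.+1) seq_balance (T.1 j) s)))).
    apply: Ex_le => s sD; have [gs|_] := boolP (good V s); last first.
      by rewrite mulr0 sumr_ge0 // => T _; rewrite exprn_ge0.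
    have := kernel_decomposition Fts fE sD gs.
    by rewrite mulr1 -(ler_nat R) natr_sum natrX; under eq_bigr => T _ do rewrite natrX.
  rewrite Ex_sum; apply: le_trans (sum_Forall_le Fts _) _.
    by move=> T TP; exact: (log_product_mean D N0 tt b0 ab TP).
  rewrite ler_wpM2r ?ler_nat // mulr_ge0 ?(ltW pD) // exprn_ge0 //.
  rewrite addr_ge0 ?mulr_ge0 ?(ltW b0) ?exprn_ge0 // subr_ge0.
  by rewrite invf_le1 ?exprn_ege1 ?exprn_gt0 //; lra.
rewrite mulrCA ler_pM2l // => le; rewrite -mulrA -ler_pdivrMl // mulr1.
by apply: le_trans le; move: gp; rewrite div1r.
Qed.

(** * Asymptotics *)

From mathcomp Require Import all_classical all_reals all_analysis.
From mathcomp.real_closed Require Import complex.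
Import Order.TTheory GRing.Theory Num.Theory.
Import numFieldNormedType.Exports.
Local Open Scope classical_set_scope.
Local Open Scope ring_scope.

Lemma expR_ge_id (R : realType) (x : R) : x <= expR x.
Proof. by apply: le_trans (expR_ge1Dx x); rewrite lerDr. Qed.

Lemma expR_ge_sqr (R : realType) (x : R) : 0 <= x -> x ^+ 2 / 4 <= expR x.
Proof.
move=> x0; have := expR_ge1Dx (x / 2).
have -> : expR x = expR (x / 2) ^+ 2 by rewrite -expRM_natl; congr expR; lra.
by move: (expR _) => e; nra.
Qed.

Lemma powR_expR (R : realType) (x a : R) : 0 < x -> x `^ a = expR (a * ln x).
Proof. by move=> x0; rewrite /powR gt_eqF. Qed.

(* E will be n^(delta/20), so that k is within 1 of E^20. *)
Lemma rho_bound (R : realType) (E : R) (a t D : nat) :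
    81 <= E -> E ^+ 5 - 1 <= a%:R <= E ^+ 5 -> 9 ^+ t <= E ^+ 10 ->
    E ^+ 20 - 1 <= D%:R ->
  8 * E^-1 + 2 ^+ a * (1 - (9 ^+ t)^-1) ^+ D <= 9 / E.
Proof.
move=> E81 /andP[_ aE] tE DE.
have E0 : 0 < E by lra.
have e1 : 2 ^+ a <= expR (E ^+ 5).
  apply: (@le_trans _ _ (expR a%:R)); last by rewrite ler_expR.
  rewrite -[a%:R]mulr1 expRM_natl lerXn2r ?nnegrE ?expR_ge0 //.
  by have := expR_ge1Dx (1 : R); lra.
have t0 : 0 < (9 : R) ^+ t by rewrite exprn_gt0.
have t1 : 1 <= (9 : R) ^+ t by rewrite exprn_ege1 //; lra.
have i0 : 0 <= 1 - ((9 : R) ^+ t)^-1 by rewrite subr_ge0 invf_le1.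
have e2 : (1 - ((9 : R) ^+ t)^-1) ^+ D <= expR (- (E ^+ 10 - 1)).
  apply: (@le_trans _ _ (expR (- ((9 : R) ^+ t)^-1) ^+ D)).
    rewrite lerXn2r ?nnegrE ?expR_ge0 //; exact: expR_ge1Dx.
  rewrite -expRM_natl ler_expR mulrN lerN2.
  apply: (@le_trans _ _ ((E ^+ 20 - 1) / E ^+ 10)).
    rewrite mulrBl -[20%N]/(10 + 10)%N exprD mulfK ?expf_neq0 ?gt_eqF //.
    rewrite lerD2l lerN2 mul1r invf_le1 ?exprn_gt0 // exprn_ege1 //; lra.
  rewrite ler_pM ?invr_ge0 ?exprn_ge0 ?(ltW E0) ?lef_pV2 ?posrE ?exprn_gt0 //.
  by rewrite subr_ge0 exprn_ege1 //; lra.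
have e3 : expR (E ^+ 5) * expR (- (E ^+ 10 - 1)) <= E^-1.
  rewrite -expRD -[E^-1]mulr1 -[X in _ <= X]mulrC mul1r.
  apply: (@le_trans _ _ (expR (- E))); last first.
    by rewrite expRN lef_pV2 ?posrE ?expR_gt0 //; exact: expR_ge_id.
  (* With [y = E^5] the claim is [E <= y^2 - 1 - y]. *)
  rewrite ler_expR; have : E <= E ^+ 5 by rewrite -[X in X <= _]expr1 ler_weXn2l //; lra.
  rewrite (exprM _ 5 2); move: (E ^+ 5) => y Ey; nra.
have : 2 ^+ a * (1 - (9 ^+ t)^-1) ^+ D <= E^-1.
  by apply: le_trans e3; apply: ler_pM => //; rewrite exprn_ge0.
by lra.
Qed.

(** With [w = y^2 / 5120], the factor [rho^tau] is at most [exp(-2 w)]; one of the two factors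
    [exp w] absorbs the constant 128. *)
Lemma size_from_rho (R : realType) (y rho s : R) (tau : nat) :
    40 * 40 <= y -> y / 64 <= tau%:R -> 0 <= rho -> rho <= expR (- (y / 40)) ->
    0 <= s -> 1 <= 128 * s * rho ^+ tau ->
  expR (y ^+ 2 / (64 * 80)) <= s.
Proof.
move=> y_ge tau_ge rho0 rho_le s0 fin; pose w := y ^+ 2 / (64 * 80).
have yy : 40 * 40 * y <= y ^+ 2 by rewrite expr2 ler_wpM2r //; lra.
have e128 : 128 <= expR w by apply: le_trans (expR_ge1Dx _); rewrite /w; lra.
have e0 : 0 < expR w by exact: expR_gt0.
have rho_tau : rho ^+ tau <= (expR w)^-1 ^+ 2.
  apply: (@le_trans _ _ (expR (- (y / 40)) ^+ tau)).
    by rewrite lerXn2r ?nnegrE ?expR_ge0.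
  rewrite -expRN -!expRM_natl ler_expR /w.
  have y0 : 0 <= y by lra.
  by have := ler_wpM2r y0 tau_ge; rewrite expr2; lra.
have : 1 <= 128 * s * (expR w)^-1 ^+ 2.
  by apply: le_trans fin _; rewrite ler_wpM2l ?mulr_ge0.
rewrite exprVn ler_pdivlMr ?exprn_gt0 // mul1r expr2 => ee.
by have := ler_wpM2r (ltW e0) e128; rewrite -/w; lra.
Qed.

Lemma formula_size_lower_bound (R : realType) (K : fieldType) (delta C : R)
    (n d k : nat) (h : {poly 'F_2}) (hI : monic_irreducible_poly h)
    (label : 'I_n -> {poly %/ h with hI}) (F : formula K (n * 2 ^ d)) :
    0 < delta -> delta < 1 / 2 -> 0 < C ->
    40 * 40 <= delta * ln n%:R -> 32 * 64 * C <= (1 - 2 * delta) ^+ 2 * ln n%:R ->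
    ln n%:R / ln 2 <= d%:R :> R -> d%:R <= C * ln n%:R ->
    `|k%:R - n%:R `^ delta| < 1 -> size h = d.+1 -> injective label ->
    multilinear_formula F -> represents F (kernel_indicator K (Vbin d k label)) ->
  n%:R `^ (delta ^+ 2 / (64 * 80) * ln n%:R) <= (formula_size F)%:R :> R.
Proof.
move=> de0 de1 C0 x1 x2 d1 d2 kE sh label_inj MF repF.
have x0 : 0 < ln n%:R :> R by rewrite -(pmulr_rgt0 _ de0); lra.
have n0 : (0 < n)%N by rewrite lt0n; apply: contraTN x0 => /eqP ->; rewrite ln0 // ltxx.
have nR : 0 < n%:R :> R by rewrite ltr0n.
have nE : n%:R = expR (ln n%:R) :> R by rewrite lnK.
have d0 : (0 < d)%N.
  rewrite -(ltr0n R); apply: lt_le_trans d1; rewrite divr_gt0 // ln_gt0 //; lra.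
rewrite powR_expR // in kE; rewrite powR_expR //.
move: (ln n%:R) x0 x1 x2 {d1} d2 nE kE => x x0 x1 x2 d2 nE kE.
pose E := expR (delta * x / 20).
have EX i : E ^+ i = expR (i%:R * (delta * x / 20)) by rewrite expRM_natl.
have E81 : 81 <= E by apply: le_trans (expR_ge1Dx _); lra.
have E20 : expR (delta * x) = E ^+ 20 by rewrite EX; congr expR; lra.
have E1 : 1 <= E by lra.
have EX1 i : 1 <= E ^+ i by rewrite exprn_ege1.
rewrite {}E20 in kE.
have k1 : E ^+ 20 - 1 <= k%:R by move: kE; rewrite ltr_norml => /andP[]; lra.
have k2 : k%:R <= 2 * E ^+ 20 by have := EX1 20%N; move: kE; rewrite ltr_norml => /andP[]; lra.
have k0 : (0 < k)%N.
  rewrite -(ltr0n R); apply: lt_le_trans k1; rewrite subr_gt0.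
  by rewrite exprn_egt1 //; lra.
have D0 : (0 < k * d)%N by rewrite muln_gt0 k0.
have DE : E ^+ 20 - 1 <= (k * d)%:R.
  by apply: le_trans k1 _; rewrite ler_nat leq_pmulr.
(* The numerator is at most [4 E^40 C x] and [n] is [E^40] times [exp((1 - 2 delta) x)], whose
   quadratic growth beats [512 C x]. *)
have kD : (k * (k * d))%:R / n%:R <= 1 / 128 :> R.
  rewrite ler_pdivrMr // !natrM nE.
  apply: (@le_trans _ _ (2 * E ^+ 20 * (2 * E ^+ 20 * (C * x)))).
    by rewrite !ler_pM ?mulr_ge0.
  have g0 : 0 <= (1 - 2 * delta) * x by rewrite mulr_ge0 ?(ltW x0) //; lra.
  have -> : expR x = E ^+ 40 * expR ((1 - 2 * delta) * x).
    by rewrite EX -expRD; congr expR; lra.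
  have := expR_ge_sqr g0; rewrite exprMn => ge.
  have {}ge : 8 * 64 * C * x <= expR ((1 - 2 * delta) * x).
    by apply: le_trans ge; have := ler_wpM2r (ltW x0) x2; rewrite expr2; lra.
  clear x2.
  have -> : E ^+ 40 = E ^+ 20 * E ^+ 20 by rewrite -exprD.
  have := ler_wpM2l (mulr_ge0 (le_trans ler01 (EX1 20%N)) (le_trans ler01 (EX1 20%N))) ge.
  by move: (E ^+ 20) (expR _) => y z; lra.
have dx : delta * x <= x / 2 by have := ler_wpM2r (ltW x0) (ltW de1); lra.
(* Since [9 <= exp 8], this choice keeps [9^t] below [n^(delta/2)], that is [E^10]. *)
pose t := Num.truncn (delta * x / 16).
have [t1 t2] : t%:R <= delta * x / 16 /\ delta * x / 16 < t%:R + 1.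
  have /truncn_itv /andP[] : 0 <= delta * x / 16 by lra.
  by rewrite -/t -[t.+1%:R]natr1 => ? ?; split.
have tE : 9 ^+ t <= E ^+ 10.
  apply: (@le_trans _ _ (expR (t%:R * 8))).
    rewrite expRM_natl lerXn2r ?nnegrE ?expR_ge0 //.
    by have := expR_ge1Dx (8 : R); lra.
  by rewrite EX ler_expR; lra.
pose a := Num.truncn (E ^+ 5).
have aE : E ^+ 5 - 1 <= a%:R <= E ^+ 5.
  have /truncn_itv /andP[] : 0 <= E ^+ 5 by rewrite exprn_ge0 //; lra.
  by rewrite -/a -[a.+1%:R]natr1 => a1 a2; apply/andP; split; lra.
have E0 : 0 < E by lra.
have ab : 1 <= a%:R * E^-1 ^+ 4.
  rewrite exprVn ler_pdivlMr ?exprn_gt0 // mul1r.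
  case/andP: aE => + _; apply: le_trans; rewrite [E ^+ 5]exprS.
  by have := EX1 4%N; move: (E ^+ 4) => y; nra.
have tN : (2 * 3 ^ t <= n * 2 ^ d)%N.
  rewrite mulnC leq_mul //; last by rewrite -[X in (X <= _)%N]expn1 leq_exp2l.
  apply: (@leq_trans (9 ^ t)); first by case: (t) => // t'; rewrite leq_exp2r.
  rewrite -(ler_nat R) natrX nE; apply: le_trans tE _.
  by rewrite EX ler_expR; lra.
pose tau := t.+1./2.
have tt : (tau.*2 <= t.+1)%N by rewrite -geq_half_double.
have Ei0 : 0 < E^-1 by rewrite invr_gt0.
have := combinatorial_bound sh label_inj n0 D0 kD tN tt Ei0 ab MF repF.
have := rho_bound E81 aE tE DE; set rho := 8 * E^-1 + _ => rho_le.
have rho0 : 0 <= rho.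
  rewrite /rho addr_ge0 ?mulr_ge0 ?(ltW Ei0) ?exprn_ge0 // subr_ge0.
  by rewrite invf_le1 ?exprn_ege1 ?exprn_gt0 //; lra.
(* Half of the exponent of [1 / E] absorbs the factor 9. *)
have rho_exp : rho <= expR (- (delta * x / 40)).
  apply: le_trans rho_le _; rewrite ler_pdivrMr // -expRD.
  by apply: le_trans (expR_ge1Dx _); lra.
have tau_ge : delta * x / 64 <= tau%:R.
  have : (t <= 2 * tau)%N by rewrite mul2n -leq_uphalf_double.
  by rewrite -(ler_nat R) natrM; lra.
move=> fin; rewrite (_ : _ * x * x = (delta * x) ^+ 2 / (64 * 80)); last first.
  by rewrite exprMn [x ^+ 2]expr2 -mulrA mulrAC.
exact: size_from_rho x1 tau_ge rho0 rho_exp (ler0n _ _) fin.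
Qed.

Theorem theorem17 (R : realType) (delta : R) (d : nat -> nat)
    (delta_gt0 : 0 < delta) (delta_lt : delta < 1 / 2)
    (d_ge : forall n : nat, (0 < n)%N -> ln n%:R / ln 2 <= (d n)%:R :> R)
    (d_bigO : (fun n : nat => (d n)%:R : R) =O_\oo (fun n : nat => ln n%:R : R)) :
  exists2 c : R, 0 < c &
    \forall n \near \oo,
      forall (k : nat) (h : {poly 'F_2}) (hI : monic_irreducible_poly h)
        (label : 'I_n -> {poly %/ h with hI}),
      `|k%:R - n%:R `^ delta| < 1 ->
      size h = (d n).+1 ->
      injective label ->
      n%:R `^ (c * ln n%:R) <=
        (MFS (kernel_indicator R[i] (Vbin (d n) k label)))%:R :> R.
Proof.
exists (delta ^+ 2 / (64 * 80)); first by rewrite divr_gt0 ?exprn_gt0 ?mulr_gt0 ?ltr0n.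
have /eqO_exP [C C0 dC] := d_bigO.
(* Once [ln n] exceeds [X], both numerical hypotheses of the explicit bound hold. *)
pose X := 40 * 40 / delta + 32 * 64 * C / (1 - 2 * delta) ^+ 2.
near=> n => k h hI label kE sh label_inj.
rewrite /MFS; case: ex_minnP => s /asboolP[F [MF repF <-]] _.
have gam : 0 < (1 - 2 * delta) ^+ 2 by rewrite exprn_gt0 //; lra.
have nX : expR X <= n%:R by near: n; exact: nbhs_infty_ger.
have n0 : 0 < n%:R :> R by apply: lt_le_trans nX; exact: expR_gt0.
have Xn : X <= ln n%:R by rewrite -ler_expR lnK.
have X1 : 0 <= 40 * 40 / delta by rewrite divr_ge0 ?mulr_ge0 ?ler0n ?(ltW delta_gt0).
have X2 : 0 <= 32 * 64 * C / (1 - 2 * delta) ^+ 2.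
  by apply: divr_ge0; [rewrite !mulr_ge0 ?ler0n ?(ltW C0)|exact: ltW].
have dn : `|(d n)%:R : R| <= C * `|ln n%:R : R| by near: n; exact: dC.
rewrite ger0_norm // ger0_norm in dn; last by apply: le_trans Xn; exact: addr_ge0.
have x1 : 40 * 40 <= delta * ln n%:R.
  by rewrite [leRHS]mulrC -ler_pdivrMr //; apply: le_trans Xn; rewrite lerDl.
have x2 : 32 * 64 * C <= (1 - 2 * delta) ^+ 2 * ln n%:R.
  by rewrite [leRHS]mulrC -ler_pdivrMr //; apply: le_trans Xn; rewrite lerDr.
have d1 : ln n%:R / ln 2 <= (d n)%:R :> R by apply: d_ge; rewrite -(ltr0n R).
exact: (formula_size_lower_bound delta_gt0 delta_lt C0 x1 x2 d1 dn kE sh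
  label_inj MF repF).
Unshelve. all: by end_near.
Qed.
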